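(* Let $k\ge 2$ and $t\ge 4$ be integers and let $c>0$ be a real number. If $\theta\ge 0$ is the second largest eigenvalue of $\boldsymbol{B}(k,t,c)$, then $$b(k,\theta)\le M(k,t,c)=2\left(\sum_{i=0}^{t-4}(k-1)^i+\frac{(k-1)^{t-3}}{c}+\frac{(k-1)^{t-2}}{c}\right).$$ Equality holds if and only if there exists a bipartite distance-regular graph whose quotient matrix with respect to the distance-partition from a vertex is $\boldsymbol{B}(k,t,c)$ (in the case $1\le c<k$) or $\boldsymbol{B}(k,t-1,1)$ (in the case $c=k$).
   Context: Graphs are finite and simple. $b(k,\theta)$ denotes the maximum order (number of vertices) of a connected bipartite $k$-regular graph $\Gamma$ with $\lambda_2(\Gamma)\le\theta$, where $\lambda_2(\Gamma)$ is the second largest eigenvalue of the adjacency matrix of $\Gamma$ (eigenvalues counted with multiplicity). For an integer $t\ge 4$ and real $c>0$, $\boldsymbol{B}(k,t,c)$ is the $t\times t$ tridiagonal matrix with lower diagonal $(1,\ldots,1,c,k)$ (with $t-3$ ones), upper diagonal $(k,k-1,\ldots,k-1,k-c)$ (with $t-3$ entries $k-1$), and constant row sum $k$ (so the diagonal is zero). Also $\boldsymbol{B}(k,3,1)=\begin{pmatrix}0&k&0\\1&0&k-1\\0&k&0\end{pmatrix}$. For $c>k$ the matrix $\boldsymbol{B}(k,t,c)$ may have non-real eigenvalues; ''second largest eigenvalue'' means the second largest among its real eigenvalues (the largest being $k$). The quotient matrix of a distance-regular graph with respect to the distance-partition from a vertex $x$ is the matrix, with rows and columns indexed by $0,1,\ldots,d$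 ($d$ the diameter), whose $(i,j)$ entry is the number of neighbours at distance $j$ from $x$ of any given vertex at distance $i$ from $x$. *)

(* Defs.v *)
From mathcomp Require Import all_boot all_order all_algebra.
From mathcomp Require Import polyrcf reals.

Set Implicit Arguments.
Unset Strict Implicit.
Unset Printing Implicit Defensive.

Import Order.TTheory GRing.Theory Num.Theory.

Local Open Scope ring_scope.

Record sgraph := SGraph {
  vertex :> finType;
  adj : rel vertex;
  adj_sym : symmetric adj;
  adj_irr : irreflexive adj
}.

(* The graph with no vertices is not counted as connected. *)
Definition connected (G : sgraph) : Prop :=
  (0 < #|G|)%N /\ forall x y : G, connect (@adj G) x y.

Definition bipartite (G : sgraph) : Prop :=
  exists side : G -> bool, forall x y : G, adj x y -> side x != side y.

Definition regular (k : nat) (G : sgraph) : Prop :=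
  forall x : G, #|[set y | adj x y]| = k.

Definition walk (G : sgraph) (n : nat) (x y : G) : bool :=
  [exists p : n.-tuple G, path (@adj G) x p && (last x p == y)].

(* Least length of a walk from x to y. It is less than #|G| when x and y are in
   the same component; the value #|G| encodes an infinite distance. *)
Definition gdist (G : sgraph) (x y : G) : nat :=
  find (fun n => walk n x y) (iota 0 #|G|).

Definition diameter (G : sgraph) : nat :=
  (\max_(x : G) \max_(y : G) gdist x y)%N.

Definition nbrs_at (G : sgraph) (x y : G) (j : nat) : nat :=
  #|[set z : G | adj y z & gdist x z == j]|.

Definition distance_regular (G : sgraph) : Prop :=
  connected G /\
  forall x y x' y' : G, gdist x y = gdist x' y' ->
    forall j : nat, nbrs_at x y j = nbrs_at x' y' j.

(* For distance-regular G all the classes 0, ..., diameter G of the distance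
   partition from x are nonempty, so at most one Q satisfies this. *)
Definition distance_quotient (R : realType) (G : sgraph) (x : G) (n : nat)
    (Q : 'M[R]_n) : Prop :=
  n = (diameter G).+1 /\
  forall (i j : 'I_n) (y : G), gdist x y = i -> Q i j = (nbrs_at x y j)%:R.

Definition adjacency (R : realType) (G : sgraph) : 'M[R]_#|G| :=
  \matrix_(i, j) (adj (enum_val i) (enum_val j))%:R.

(* In nonincreasing order, repeated according to algebraic multiplicity. *)
Definition real_eigenvalues (R : realType) (n : nat) (A : 'M[R]_n) : seq R :=
  flatten [seq nseq (mup x (char_poly A)) x | x <- rev (rootsR (char_poly A))].

(* The default value 0 is not reached for the matrices considered below: the
   adjacency matrix of a connected bipartite k-regular graph (k >= 1) and
   B(k, t, c) both have the eigenvalues k and -k. *)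
Definition lambda2 (R : realType) (n : nat) (A : 'M[R]_n) : R :=
  nth 0 (real_eigenvalues A) 1.

(* For t = 3 and c = 1 the formula also gives the separately defined matrix
   B(k, 3, 1). *)
Definition Bmx (R : realType) (k t : nat) (c : R) : 'M[R]_t :=
  \matrix_(i < t, j < t)
    if i == j.+1 :> nat then
      if i == t.-1 :> nat then k%:R else if i == t.-2 :> nat then c else 1
    else if j == i.+1 :> nat then
      if i == 0%N :> nat then k%:R
      else if i == t.-2 :> nat then k%:R - c else k%:R - 1
    else 0.

Definition Mbound (R : realType) (k t : nat) (c : R) : R :=
  2 * (\sum_(0 <= i < (t - 4).+1) (k%:R - 1) ^+ i
       + (k%:R - 1) ^+ (t - 3) / c + (k%:R - 1) ^+ (t - 2) / c).

Definition admissible (R : realType) (k : nat) (theta : R) (G : sgraph) : Prop :=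
  [/\ connected G, bipartite G, regular k G & lambda2 (adjacency R G) <= theta].

(* n = b(k, theta): the maximum is attained, and bounds every order. *)
Definition is_b (R : realType) (k : nat) (theta : R) (n : nat) : Prop :=
  (exists G : sgraph, admissible k theta G /\ #|G| = n) /\
  (forall G : sgraph, admissible k theta G -> (#|G| <= n)%N).

Definition bipartite_drg_with_quotient (R : realType) (n : nat) (Q : 'M[R]_n) :
    Prop :=
  exists G : sgraph,
    [/\ bipartite G, distance_regular G
      & exists x : G, distance_quotient x Q].

(* Main.v *)
Require Import Defs.
From mathcomp Require Import all_boot all_order all_algebra.
From mathcomp Require Import complex polyrcf boolp reals.
From mathcomp Require Import zify ring lra.

(* Write q = k - 1 and m = t - 4.  The polynomials G_j with G_0 = 1, G_1 = X,
   G_(j+2) = X G_(j+1) - q G_j count walks: for a k-regular graph with adjacency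
   matrix A, the entries of G_j(A) - G_(j-2)(A) are numbers of nonbacktracking
   walks of length j.  The characteristic polynomial of B(k,t,c) is
   (X^2 - k^2) P with P = G_(m+2) + (c - 1) G_m, so theta is the largest real
   root of P, and by the Christoffel-Darboux identity g = P / (X^2 - theta^2) is
   a nonnegative combination of the G_j with j = m mod 2 and j <= m.

   Bound: P g <= 0 at all eigenvalues except k and -k, so
   tr (P(A) g(A)) <= 2 P(k) g(k).  Entrywise P(A) >= c G_m(A) >= c G_j(A), and
   these are natural numbers, so tr (P(A) G_j(A)) >= c |G| G_j(k).  Hence
   c |G| <= 2 P(k) = c M(k,t,c).

   Equality: then P vanishes at the other eigenvalues, so tr P(A)^2 = 2 P(k)^2,
   and a Cauchy-Schwarz argument shows that the entries of P(A) at the pairs at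
   distance = m mod 2 are all equal to c.  This determines the intersection
   numbers: c_i = 1 for i <= m + 1, c_(m+2) = c, and the diameter is m + 3 if
   c < k and m + 2 if c = k.  Conversely these intersection numbers give back
   the entries of P(A), hence tr P(A)^2, which forces P to vanish at all
   eigenvalues other than k and -k. *)

Set Implicit Arguments.
Unset Strict Implicit.
Unset Printing Implicit Defensive.

Import Order.TTheory GRing.Theory Num.Theory.

Local Open Scope ring_scope.

(** * Spectra of matrices *)

(** Only the block of copies of [x] contributes. Eigenvalue lists can hence be compared as multisets
    through [char_poly]. *)
Lemma count_real_eigenvalues (R : realType) (n : nat) (A : 'M[R]_n) (x : R) :
  count_mem x (real_eigenvalues A) = mup x (char_poly A).
Proof.
have p0 : char_poly A != 0 by apply: monic_neq0; exact: char_poly_monic.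
rewrite /real_eigenvalues; move: (char_poly A) p0 => p p0.
rewrite count_flatten -map_comp.
have e (m : R -> nat) y : count_mem x (nseq (m y) y) = ((y == x) * m x)%N.
  rewrite count_nseq /=.
  by have [->|_] := eqVneq y x.
rewrite (eq_map (e (fun y => mup y p))) sumnE big_map -big_distrl /=.
have -> : (\sum_(i <- rev (rootsR p)) (i == x))%N = count_mem x (rootsR p).
  by rewrite -sum1_count big_rev [RHS]big_mkcond /=; apply: eq_bigr => i _; case: (i == x).
rewrite count_uniq_mem ?uniq_roots // -roots_on_rootsR //.
rewrite inE /=; case: (boolP (root p x)) => [_|h]; first by rewrite mul1n.
by rewrite mul0n mupNroot.
Qed.

Lemma sorted_real_eigenvalues (R : realType) (n : nat) (A : 'M[R]_n) :
  sorted >=%R (real_eigenvalues A).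
Proof.
rewrite sorted_pairwise; last exact: ge_trans.
rewrite /real_eigenvalues.
have : pairwise >%R (rev (rootsR (char_poly A))).
  rewrite -sorted_pairwise; last by move=> x y z /= h1 h2; apply: lt_trans h2 h1.
  by rewrite rev_sorted sorted_roots.
elim: (rev _) => [|x s IHs] //= /andP [/allP hx /IHs hs].
rewrite pairwise_cat hs andbT; apply/andP; split; last first.
  by elim: (mup _ _) => //= m ->; rewrite andbT; apply/allP => y /nseqP [-> _] /=.
apply/allrelP => y z /nseqP [-> _] /flattenP [l /mapP [w ws ->]] /nseqP [-> _].
by apply: ltW; apply: hx.
Qed.

(** In a sorted list the second entry is at most [theta] iff at most one entry exceeds [theta].
    Nonnegativity of [theta] covers the default value 0 of lists with fewer than two entries. *)
Lemma lambda2_le (R : realType) (n : nat) (A : 'M[R]_n) (theta : R) :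
  0 <= theta ->
  (lambda2 A <= theta) = (count (fun x => (theta < x)%R) (real_eigenvalues A) <= 1)%N.
Proof.
move=> h0; rewrite /lambda2; move: (sorted_real_eigenvalues A).
case: (real_eigenvalues A) => [|x [|y s]] /=; rewrite ?h0 //.
  by rewrite addn0 leq_b1.
move=> /andP [yx ys]; case: (ltP theta y) => hy.
  by rewrite (lt_le_trans hy yx).
have -> : count (fun x => (theta < x)%R) s = 0%N.
  apply/eqP; rewrite -leqn0 leqNgt -has_count; apply/hasPn => z zs.
  move: ys; rewrite (path_sortedE (@ge_trans _ _)) => /andP [/allP h _].
  by rewrite -leNgt (le_trans (h _ zs)).
by rewrite !addn0 leq_b1.
Qed.

Lemma char_poly_conj (F : fieldType) (n : nat) (P B : 'M[F]_n) :
  P \in unitmx -> char_poly (invmx P *m B *m P) = char_poly B.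
Proof.
move=> Pu.
have e : map_mx polyC (invmx P) *m map_mx polyC P = 1%:M.
  by rewrite -map_mxM mulVmx // map_scalar_mx.
rewrite /char_poly.
have -> : char_poly_mx (invmx P *m B *m P) =
   map_mx polyC (invmx P) *m char_poly_mx B *m map_mx polyC P.
  rewrite /char_poly_mx mulmxBr mulmxBl !map_mxM mul_mx_scalar -scalemxAl.
  by rewrite e scale_scalar_mx mulr1.
by rewrite !det_mulmx mulrAC -det_mulmx e det1 mul1r.
Qed.

Lemma char_poly_diag (F : fieldType) (n : nat) (D : 'rV[F]_n) :
  char_poly (diag_mx D) = \prod_i ('X - (D 0 i)%:P).
Proof.
rewrite char_poly_trig ?diag_mx_is_trig //.
by apply: eq_bigr => i _; rewrite mxE eqxx mulr1n.
Qed.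

(** A real symmetric matrix is hermitian over [R[i]], so the complex spectral theorem applies; its
    spectrum is real, so the diagonal comes from [R]. *)
Lemma symmetric_diagonalization (R : rcfType) (n : nat) (A : 'M[R]_n) :
  A^T = A -> exists P : 'M[R[i]]_n, exists r : 'rV[R]_n,
    P \in unitmx /\ map_mx (real_complex R) A =
      invmx P *m diag_mx (map_mx (real_complex R) r) *m P.
Proof.
move=> Asym; set B := map_mx _ A.
have Bherm : B \is hermsymmx.
  apply/is_hermitianmxP; rewrite expr0 scale1r.
  apply/matrixP => i j; rewrite !mxE -[in LHS]Asym mxE.
  by apply/esym/CrealP; rewrite complex_real.
have /orthomx_spectralP e := hermitian_normalmx Bherm.
have rl := hermitian_spectral_diag_real Bherm.
exists (spectralmx B), (map_mx (@complex.Re R) (spectral_diag B)).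
split; first exact: spectral_unit.
suff -> : map_mx (real_complex R) (map_mx (@complex.Re R) (spectral_diag B)) =
  spectral_diag B by exact: e.
apply/matrixP => i j; rewrite !mxE RRe_real //.
by move/mxOverP: rl; exact.
Qed.
(** * The polynomials G_j *)

(** Rescaled Chebyshev polynomials of the second kind: for q > 0, [gpoly q n] is q^(n/2) U_n(X / (2
    sqrt q)). *)
Fixpoint gpoly (R : comNzRingType) (q : R) (n : nat) : {poly R} :=
  if n is m.+1 then
    if m is l.+1 then 'X * gpoly q m - q *: gpoly q l else 'X
  else 1.

Definition ppoly (R : comNzRingType) (q c : R) (m : nat) : {poly R} :=
  gpoly q m.+2 + (c - 1) *: gpoly q m.

Arguments gpoly : simpl never.

Lemma gpolySS (R : comNzRingType) (q : R) (n : nat) :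
  gpoly q n.+2 = 'X * gpoly q n.+1 - q *: gpoly q n.
Proof. by []. Qed.

Lemma horner_gpoly0 (R : comNzRingType) (q x : R) : (gpoly q 0).[x] = 1.
Proof. exact: hornerC. Qed.

Lemma horner_gpoly1 (R : comNzRingType) (q x : R) : (gpoly q 1).[x] = x.
Proof. exact: hornerX. Qed.

Lemma horner_gpolySS (R : comNzRingType) (q x : R) (n : nat) :
  (gpoly q n.+2).[x] = x * (gpoly q n.+1).[x] - q * (gpoly q n).[x].
Proof. by rewrite gpolySS !hornerE. Qed.

Lemma horner_ppoly (R : comNzRingType) (q c x : R) (m : nat) :
  (ppoly q c m).[x] = (gpoly q m.+2).[x] + (c - 1) * (gpoly q m).[x].
Proof. by rewrite hornerD hornerZ. Qed.


Lemma two_step_ind (P : nat -> Prop) :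
  P 0 -> P 1 -> (forall n, P n -> P n.+1 -> P n.+2) -> forall n, P n.
Proof.
move=> p0 p1 pS n; suff [] : P n /\ P n.+1 by [].
by elim: n => [|n [h1 h2]]; split=> //; apply: pS.
Qed.

Lemma gpoly_monic_size (R : comNzRingType) (q : R) (n : nat) :
  gpoly q n \is monic /\ size (gpoly q n) = n.+1.
Proof.
elim/two_step_ind: n => [||n [m1 s1] [m2 s2]].
- by rewrite monic1 size_poly1.
- by rewrite monicX size_polyX.
have sXg : size ('X * gpoly q n.+1) = n.+3.
  by rewrite mulrC size_mulX ?s2 //; apply: monic_neq0.
have lt : (size (- (q *: gpoly q n))%R < size ('X * gpoly q n.+1)%R)%N.
  by rewrite sXg size_polyN (leq_ltn_trans (size_scale_leq _ _)) // s1; lia.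
rewrite gpolySS monicE lead_coefDl // size_polyDl // sXg; split=> //.
by rewrite -monicE monicMl // monicX.
Qed.

Lemma ppoly_monic_size (R : comNzRingType) (q c : R) (m : nat) :
  ppoly q c m \is monic /\ size (ppoly q c m) = m.+3.
Proof.
have [m2 s2] := gpoly_monic_size q m.+2.
have lt : (size ((c - 1) *: gpoly q m)%R < size (gpoly q m.+2))%N.
  have [_ s0] := gpoly_monic_size q m.
  by rewrite s2 (leq_ltn_trans (size_scale_leq _ _)) // s0; lia.
by rewrite /ppoly monicE lead_coefDl // size_polyDl // -monicE.
Qed.

Lemma gpolyN (R : comNzRingType) (q x : R) (n : nat) :
  (gpoly q n).[- x] = (-1) ^+ n * (gpoly q n).[x].
Proof.
elim/two_step_ind: n => [||n h1 h2]; first by rewrite !horner_gpoly0 mul1r.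
  by rewrite !horner_gpoly1 expr1 mulN1r.
by rewrite !horner_gpolySS h1 h2 !exprS; ring.
Qed.

Lemma ppolyN (R : comNzRingType) (q c x : R) (m : nat) :
  (ppoly q c m).[- x] = (-1) ^+ m * (ppoly q c m).[x].
Proof. by rewrite !horner_ppoly !gpolyN !exprS; ring. Qed.

Lemma gpoly_degree_value (R : comNzRingType) (q : R) (n : nat) :
  (gpoly q n).[q + 1] = \sum_(0 <= i < n.+1) q ^+ i.
Proof.
elim/two_step_ind: n => [||n h1 h2].
- by rewrite big_nat1 expr0 horner_gpoly0.
- by rewrite big_nat_recr //= big_nat1 expr0 expr1 horner_gpoly1 addrC.
rewrite horner_gpolySS h1 h2 [RHS]big_nat_recr //= [in RHS]big_nat_recr //=.
by rewrite big_nat_recr //= !exprS; ring.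
Qed.

(** Joint induction: for x >= q + 1 the recurrence gives G_(n+2) >= (q + 1) G_(n+1) - q G_(n+1) =
    G_(n+1). *)
Lemma gpoly_gt0_le (R : realFieldType) (q x : R) (n : nat) : 1 <= q -> q + 1 <= x ->
  0 < (gpoly q n).[x] /\ (gpoly q n).[x] <= (gpoly q n.+1).[x].
Proof.
move=> q1 hx; elim: n => [|n [h1 h2]]; first by rewrite horner_gpoly0 horner_gpoly1; split; lra.
have h3 : 0 < (gpoly q n.+1).[x] by lra.
by split=> //; rewrite horner_gpolySS; nra.
Qed.

Lemma gpoly_gt0 (R : realFieldType) (q x : R) (n : nat) :
  1 <= q -> q + 1 <= x -> 0 < (gpoly q n).[x].
Proof. by move=> q1 hx; case: (gpoly_gt0_le n q1 hx). Qed.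

(** By monotonicity P >= G_m + (c - 1) G_m = c G_m, which is positive even for c < 1. *)
Lemma ppoly_gt0 (R : realFieldType) (q c x : R) (m : nat) : 1 <= q -> 0 < c -> q + 1 <= x ->
  0 < (ppoly q c m).[x].
Proof.
move=> q1 c0 hx; rewrite horner_ppoly.
have [h1 h2] := gpoly_gt0_le m q1 hx; have [_ h3] := gpoly_gt0_le m.+1 q1 hx.
nra.
Qed.

(** Read backwards, the recurrence carries the common zero down to G_0 = 1, since q is nonzero. *)
Lemma gpoly_consecutive_roots (R : realFieldType) (q x : R) (n : nat) :
  1 <= q -> (gpoly q n).[x] = 0 -> (gpoly q n.+1).[x] = 0 -> False.
Proof.
move=> q1; elim: n => [|n IHn]; first by rewrite horner_gpoly0 => /eqP; rewrite oner_eq0.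
move=> h1; rewrite horner_gpolySS h1 mulr0 sub0r => /eqP.
by rewrite oppr_eq0 mulf_eq0 => /orP [/eqP h|/eqP h]; [move: q1; rewrite h; lra | exact: IHn].
Qed.

(** * Largest real roots and the positive certificate *)

(** Beyond its last root a monic polynomial has its sign at infinity; the endpoint [a] may itself be
    a root, hence the weak inequality there. *)
Lemma monic_pos_right (R : rcfType) (p : {poly R}) (a : R) : p \is monic ->
  (forall x, a < x -> ~~ root p x) ->
  0 <= p.[a] /\ (forall x, a < x -> 0 < p.[x]).
Proof.
move=> pm nr.
have sg y : (forall x, y <= x -> ~~ root p x) -> 0 < p.[y].
  move=> h; rewrite -sgr_cp0 (@sgp_pinftyP _ y).
  - by rewrite /sgp_pinfty (monicP pm) sgr1.
  - by move=> x; rewrite in_itv /= andbT; exact: h.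
  by rewrite in_itv /= lexx.
split; last by move=> x ax; apply: sg => z xz; apply: nr; apply: lt_le_trans xz.
case: (boolP (root p a)) => [/rootP -> //|na].
apply/ltW/sg => x; rewrite le_eqVlt => /predU1P [<- //|]; exact: nr.
Qed.

Lemma largest_root (R : rcfType) (p : {poly R}) (a : R) : p != 0 -> root p a ->
  exists z, [/\ a <= z, root p z & forall x, z < x -> ~~ root p x].
Proof.
move=> p0 pa.
have ms (s : seq R) x0 : x0 \in s -> exists2 z, z \in s & {in s, forall y, y <= z}.
  elim: s x0 => // y [|y' s] IHs x0 _.
    by exists y; rewrite ?mem_head // => w; rewrite inE => /eqP ->.
  have [z zs hz] := IHs y' (mem_head _ _).
  case: (leP y z) => yz.
    by exists z; rewrite 1?inE ?zs ?orbT // => w; rewrite inE => /predU1P [->|/hz].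
  exists y; rewrite ?mem_head // => w; rewrite inE => /predU1P [-> //|/hz].
  by move=> wz; apply: le_trans wz (ltW yz).
have rr x : (x \in rootsR p) = root p x by rewrite -roots_on_rootsR // inE.
have [z zs hz] : exists2 z, z \in rootsR p & {in rootsR p, forall y, y <= z}.
  by apply: (ms _ a); rewrite rr.
exists z; rewrite -rr; split=> //; first by apply: hz; rewrite rr.
by move=> x zx; rewrite -rr; apply/negP => /hz; rewrite leNgt zx.
Qed.

(* The largest root of [ppoly q c m] lies beyond those of [gpoly q i], i <= m:
   at the largest root z of these, [gpoly q m] vanishes and
   [ppoly q c m] takes the value - z q (gpoly q m.-1).[z]. *)
Lemma gpoly_gt0_at_largest_root (R : rcfType) (q c theta : R) (m : nat) : 1 <= q ->
  0 <= theta -> (forall x, theta < x -> ~~ root (ppoly q c m) x) ->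
  (forall i, (i <= m)%N -> 0 < (gpoly q i).[theta]) \/ (m = 1%N /\ theta = 0).
Proof.
move=> q1 t0 nr.
have mon i := (gpoly_monic_size q i).1.
pose p := \prod_(i < m.+1) gpoly q i.
have pm : p \is monic by apply: monic_prod => i _.
have proot z i : (i <= m)%N -> root (gpoly q i) z -> root p z.
  move=> im /rootP h; apply/rootP; rewrite /p horner_prod.
  by rewrite (bigD1 (Ordinal (im : (i < m.+1)%N))) //= h mul0r.
case: (boolP [exists i : 'I_m.+1, has (fun z => theta <= z) (rootsR (gpoly q i))]).
  move=> /existsP [i /hasP [a]].
  rewrite -roots_on_rootsR ?monic_neq0 // inE /= => ra ta.
  have [z [az rz nz]] := largest_root (monic_neq0 pm) (proot a i (ltn_ord i) ra).
  have tz : theta <= z by apply: le_trans az.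
  have gz j : (j <= m)%N -> 0 <= (gpoly q j).[z].
    move=> jm; apply: (monic_pos_right (mon j) _).1 => x zx.
    by apply: contra (nz x zx); exact: proot.
  have [j jm j0] : exists2 j, (j <= m)%N & (gpoly q j).[z] = 0.
    move/rootP/eqP: rz; rewrite /p horner_prod prodf_seq_eq0 => /hasP [j _ /=].
    by move/eqP => h; exists j => //; rewrite -ltnS.
  case: j jm j0 => [_|j jm j0].
    by rewrite horner_gpoly0 => /eqP; rewrite oner_eq0.
  have jp : 0 < (gpoly q j).[z].
    rewrite lt_neqAle gz ?(ltnW jm) // andbT; apply/eqP => h.
    exact: (gpoly_consecutive_roots q1 (esym h) j0).
  (* If j + 1 < m, then G_(j+2)(z) = - q G_j(z) < 0, although no G_i with i <= m is negative at
     z. *)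
  have em : m = j.+1.
    apply/eqP; rewrite eq_sym eqn_leq jm /= leqNgt; apply/negP => jm2.
    by have := gz _ jm2; rewrite horner_gpolySS j0; nra.
  have Pz : 0 <= (ppoly q c m).[z].
    apply: (monic_pos_right (ppoly_monic_size q c m).1 _).1 => x zx.
    by apply: nr; apply: le_lt_trans zx.
  have z0 : z = 0.
    move: Pz; rewrite horner_ppoly em (horner_gpolySS q z j.+1).
    rewrite (horner_gpolySS q z j) j0 => Pz; apply/eqP.
    rewrite eq_le (le_trans t0 tz) andbT leNgt; apply/negP => zp.
    have : 0 < z * (q * (gpoly q j).[z]) by rewrite !mulr_gt0 //; lra.
    by lra.
  right; split; last by apply/eqP; rewrite eq_le t0 -z0 tz.
  (* For m >= 2 the root z = 0 is impossible, because G_2(0) = - q < 0. *)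
  case: j {jm} em j0 jp => // j em j0 jp; exfalso.
  have := gz 2%N; rewrite em => /(_ isT); rewrite z0 horner_gpolySS horner_gpoly0; lra.
move=> /existsPn h; left=> i im.
have := h (Ordinal (im : (i < m.+1)%N)); move=> /hasPn /= h2.
have nri x : theta <= x -> ~~ root (gpoly q i) x.
  move=> tx; apply/negP => rx.
  have := h2 x; rewrite -roots_on_rootsR ?monic_neq0 // inE /= rx tx.
  by move=> /(_ isT).
have [h3 _] := @monic_pos_right _ _ theta (mon i) (fun x tx => nri x (ltW tx)).
by rewrite lt_neqAle h3 andbT eq_sym; exact: nri (lexx _).
Qed.

(* Christoffel-Darboux identity *)
Lemma gpoly_kernel (R : rcfType) (q x y : R) (m : nat) :
  (x ^+ 2 - y ^+ 2) * (\sum_(j < m.+1)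
    (if odd j == odd m then q ^+ (m - j) * (gpoly q j).[y] else 0) * (gpoly q j).[x])
  = (gpoly q m.+2).[x] * (gpoly q m).[y] - (gpoly q m).[x] * (gpoly q m.+2).[y].
Proof.
elim/two_step_ind: m => [||m h _].
- rewrite big_ord_recr big_ord0 /= !horner_gpolySS !horner_gpoly1 !horner_gpoly0; ring.
- rewrite !big_ord_recr big_ord0 /= !horner_gpolySS !horner_gpoly1 !horner_gpoly0; ring.
(* Passing from m to m + 2 scales the old weights by q^2 and adds the term j = m + 2; the term j = m
   + 1 has the wrong parity. *)
rewrite big_ord_recr big_ord_recr /= negbK eqxx.
have -> : (~~ odd m == odd m) = false by case: (odd m).
rewrite mul0r addr0 subnn expr0 mul1r mulrDr.
rewrite (eq_bigr (fun j : 'I_m.+1 => q ^+ 2 * ((if odd j == odd m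
   then q ^+ (m - j) * (gpoly q j).[y] else 0) * (gpoly q j).[x]))); last first.
  move=> [j hj] _ /=; case: eqP => _; last by rewrite !mul0r mulr0.
  by rewrite (_ : m.+2 - j = (m - j).+2)%N ?exprS; [ring | lia].
rewrite -mulr_sumr mulrCA h [in RHS](horner_gpolySS q x m.+2).
rewrite [in RHS](horner_gpolySS q y m.+2) (horner_gpolySS q x m.+1).
rewrite (horner_gpolySS q y m.+1).
rewrite (horner_gpolySS q x m) (horner_gpolySS q y m); ring.
Qed.

(* The certificate is g = ppoly / ('X^2 - theta^2), except when m = 1 and
   theta = 0 may be the only real root: then g = 'X works, since only x = 0 has
   to be tested. *)
Lemma lp_certificate (R : rcfType) (q c theta : R) (m : nat) : 1 <= q -> 0 < c -> 0 <= theta ->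
  root (ppoly q c m) theta ->
  (forall x, theta < x -> ~~ root (ppoly q c m) x) ->
  exists a : nat -> R,
    let g x := \sum_(j < m.+1) a j * (gpoly q j).[x] in
    [/\ forall j, 0 <= a j,
        forall j, odd j != odd m -> a j = 0,
        0 < g (q + 1),
        forall x, `|x| <= theta -> (ppoly q c m).[x] * g x <= 0
      & forall x, (ppoly q c m).[x] * g x = 0 -> root (ppoly q c m) x].
Proof.
move=> q1 c0 t0 rt nr.
have [h|[em et]] := gpoly_gt0_at_largest_root q1 t0 nr; last first.
  exists (fun j => (j == 1%N)%:R); rewrite em /=.
  have e x : \sum_(j < 2) (val j == 1%N)%:R * (gpoly q j).[x] = x.
    by rewrite !big_ord_recr big_ord0 /= horner_gpoly1; ring.
  split=> [j|j||x|x]; rewrite ?ler0n ?e //; try lra.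
  - by case: (j =P 1%N) => [->|].
  - by rewrite et normr_le0 => /eqP ->; rewrite mulr0.
  move=> /eqP; rewrite mulf_eq0 => /orP [/eqP/rootP //|/eqP ->].
  by move: rt; rewrite em et.
have gm : 0 < (gpoly q m).[theta] by apply: h.
exists (fun j => if (j <= m)%N then (if odd j == odd m
   then q ^+ (m - j) * (gpoly q j).[theta] else 0) / (gpoly q m).[theta] else 0).
set g := fun x => _ => /=.
have gE x : g x * (gpoly q m).[theta] = \sum_(j < m.+1)
    (if odd j == odd m then q ^+ (m - j) * (gpoly q j).[theta] else 0) * (gpoly q j).[x].
  rewrite /g mulr_suml; apply: eq_bigr => [[j hj]] _ /=; rewrite -ltnS hj.
  by field; apply: lt0r_neq0.
(* Since P(theta) = 0, G_(m+2)(theta) = - (c - 1) G_m(theta), and the right side of [gpoly_kernel]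
   becomes G_m(theta) P(x). *)
have PE x : (ppoly q c m).[x] = (x ^+ 2 - theta ^+ 2) * g x.
  apply: (mulIf (lt0r_neq0 gm)); rewrite -mulrA gE gpoly_kernel.
  have := rootP rt; rewrite !horner_ppoly => e0.
  by rewrite (_ : (gpoly q m.+2).[theta] = - ((c - 1) * (gpoly q m).[theta])); [ring | lra].
have q0 : 0 <= q by lra.
have a0 j : 0 <= if (j <= m)%N then (if odd j == odd m
   then q ^+ (m - j) * (gpoly q j).[theta] else 0) / (gpoly q m).[theta] else 0.
  case: leqP => // jm; apply: divr_ge0; last exact: ltW.
  by case: eqP => // _; apply: mulr_ge0; [exact: exprn_ge0 | exact/ltW/h].
split=> //.
- by move=> j /negbTE ->; rewrite mul0r; case: ifP.
- rewrite /g big_ord_recr /= leqnn eqxx subnn expr0 mul1r divff ?lt0r_neq0 // mul1r.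
  apply: ltr_wpDl; last by apply: gpoly_gt0.
  by apply: sumr_ge0 => j _; apply: mulr_ge0; [exact: a0 | exact/ltW/gpoly_gt0].
(* Here P g = (x^2 - theta^2) g^2. *)
- move=> x hx; rewrite PE -mulrA -expr2.
  have : x ^+ 2 <= theta ^+ 2 by rewrite -[x ^+ 2]real_normK ?num_real // lerXn2r ?nnegrE.
  by move=> h1; apply: mulr_le0_ge0; rewrite ?sqr_ge0 // subr_le0.
- move=> x /eqP; rewrite mulf_eq0 => /orP [/eqP/rootP //|/eqP h1].
  by apply/rootP; rewrite PE h1 mulr0.
Qed.

(** * The characteristic polynomial of B(k,t,c) *)

(** Continuant recurrence: expansion along the last row, then along the last column of the remaining
    minor. Entries are indexed by [nat] so that all leading principal minors come from one [f]. *)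
Lemma det_tridiagonal (R : comNzRingType) (f : nat -> nat -> R) (n : nat) :
  (forall i j, (i.+1 < j)%N -> f i j = 0) -> (forall i j, (j.+1 < i)%N -> f i j = 0) ->
  \det (\matrix_(i < n.+2, j < n.+2) f i j) =
    f n.+1 n.+1 * \det (\matrix_(i < n.+1, j < n.+1) f i j)
    - f n n.+1 * f n.+1 n * \det (\matrix_(i < n, j < n) f i j).
Proof.
move=> hu hl.
rewrite (expand_det_row _ ord_max) !big_ord_recr /= big1 ?add0r; last first.
  by move=> [j hj] _; rewrite !mxE /= hl ?mul0r // ltnS.
rewrite !mxE /= addrC; congr (_ * _ + _).
  rewrite /cofactor /= -signr_odd addnn odd_double expr0 mul1r.
  congr (\det _); apply/matrixP => -[i hi] [j hj]; rewrite !mxE /=.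
  by congr (f _ _); rewrite /bump; lia.
rewrite /cofactor /= -signr_odd addSn addnn oddS odd_double expr1 mulN1r mulrN.
congr (- _).
rewrite (expand_det_col _ ord_max) big_ord_recr /= big1 ?add0r; last first.
  move=> [i hi] _; rewrite !mxE /= hu ?mul0r //.
  by rewrite /bump; lia.
rewrite !mxE /cofactor /= -signr_odd addnn odd_double expr0 mul1r.
have -> : bump n.+1 n = n by rewrite /bump; lia.
have -> : bump n n = n.+1 by rewrite /bump; lia.
rewrite mulrA [X in X * _]mulrC; congr (_ * \det _).
by apply/matrixP => -[i hi] [j hj]; rewrite !mxE /=; congr (f _ _); rewrite /bump; lia.
Qed.

(** The leading principal minors D_n of X - B follow the recurrence of G_n, except that the first
    product of off-diagonal entries is k instead of k - 1 and the last two involve c. *)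
Lemma char_poly_Bmx (R : realType) (k m : nat) (c : R) :
  char_poly (Bmx k m.+4 c) =
    ('X ^+ 2 - (k%:R ^+ 2)%:P) * ppoly (k%:R - 1) c m.
Proof.
pose b (i j : nat) : R :=
  if i == j.+1 then (if i == m.+3 then k%:R else if i == m.+2 then c else 1)
  else if j == i.+1 then
    (if i == 0%N then k%:R else if i == m.+2 then k%:R - c else k%:R - 1)
  else 0.
pose f (i j : nat) : {poly R} := 'X *+ (i == j) - (b i j)%:P.
pose D n := \det (\matrix_(i < n, j < n) f i j).
have -> : char_poly (Bmx k m.+4 c) = D m.+4.
  by congr (\det _); apply/matrixP => i j; rewrite !mxE.
have hu i j : (i.+1 < j)%N -> f i j = 0.
  move=> h; rewrite /f /b; have -> : (i == j) = false by lia.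
  have -> : (i == j.+1) = false by lia.
  by have -> : (j == i.+1) = false; [lia | rewrite mulr0n subrr].
have hl i j : (j.+1 < i)%N -> f i j = 0.
  move=> h; rewrite /f /b; have -> : (i == j) = false by lia.
  have -> : (i == j.+1) = false by lia.
  by have -> : (j == i.+1) = false; [lia | rewrite mulr0n subrr].
have rec n : D n.+2 = 'X * D n.+1 - (b n n.+1 * b n.+1 n)%:P * D n.
  rewrite /D (det_tridiagonal n hu hl) /f eqxx.
  have -> : b n.+1 n.+1 = 0 by rewrite /b; have -> : (n.+1 == n.+2) = false by lia.
  have -> : (n == n.+1) = false by lia.
  have -> : (n.+1 == n) = false by lia.
  by rewrite mulr1n !mulr0n polyC0 subr0 !sub0r mulrNN polyCM.
have D0 : D 0%N = 1 by exact: det_mx00.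
have D1 : D 1%N = 'X.
  by rewrite /D det_mx11 mxE /f /b /= mulr1n polyC0 subr0.
pose q : R := k%:R - 1; pose K : {poly R} := k%:R%:P; pose C := c%:P.
have qE : q%:P = K - 1 by rewrite polyCB.
have gS n : gpoly q n.+2 = 'X * gpoly q n.+1 - (K - 1) * gpoly q n.
  by rewrite gpolySS -mul_polyC qE.
have DE n : (n <= m)%N -> D n.+2 = gpoly q n.+2 - gpoly q n /\
    D n.+1 = if n is l.+1 then gpoly q n.+1 - gpoly q l else 'X.
  elim: n => [|n IHn] nm.
    split=> //; rewrite rec D1 D0 gS (_ : b 0 1 * b 1 0 = k%:R); last first.
      by rewrite /b /= mulr1.
    by rewrite -/K /gpoly; ring.
  have [|e2 e1] := IHn; first exact: ltnW.
  split=> //; rewrite rec e2 e1 (_ : b n.+1 n.+2 * b n.+2 n.+1 = q); last first.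
    rewrite /b eqxx; have -> : (n.+1 == n.+3) = false by lia.
    have -> : (n.+2 == m.+3) = false by lia.
    have -> : (n.+2 == m.+2) = false by lia.
    have -> : (n.+1 == m.+2) = false by lia.
    by rewrite mulr1.
  rewrite qE; case: n {IHn nm e2} e1 => [_|n _]; rewrite !gS /gpoly; ring.
have [e2 e1] := DE m (leqnn m).
(* The factor k - 1 eliminates G_(m-1), which does not exist for m = 0. *)
have qD : (K - 1) * D m.+1 = K * gpoly q m.+1 - 'X * gpoly q m.
  rewrite e1; case: (m) => [|n]; first by rewrite /gpoly; ring.
  by rewrite gS; ring.
rewrite (rec m.+2) (rec m.+1).
have -> : b m.+1 m.+2 * b m.+2 m.+1 = q * c.
  rewrite /b eqxx; have -> : (m.+1 == m.+3) = false by lia.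
  have -> : (m.+2 == m.+3) = false by lia.
  by have -> : (m.+1 == m.+2) = false by lia.
have -> : b m.+2 m.+3 * b m.+3 m.+2 = (k%:R - c) * k%:R.
  by rewrite /b !eqxx; have -> : (m.+2 == m.+4) = false by lia.
rewrite /ppoly -mul_polyC (expr2 k%:R) !polyCM qE !polyCB -/q -/K -/C polyC1.
rewrite (_ : (K - 1) * C * D m.+1 = C * ((K - 1) * D m.+1)); last by ring.
rewrite qD e2 gS; ring.
Qed.

(** * The spectrum of B(k,t,c) and of symmetric matrices *)

Lemma mem_real_eigenvalues (R : realType) (n : nat) (A : 'M[R]_n) (x : R) :
  (x \in real_eigenvalues A) = root (char_poly A) x.
Proof.
rewrite -has_pred1 has_count count_real_eigenvalues -XsubC_dvd.
  by rewrite dvdp_XsubCl.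
exact/monic_neq0/char_poly_monic.
Qed.

Lemma count_ge2 (T : eqType) (p : pred T) (x y : T) (s : seq T) :
  x != y -> x \in s -> y \in s -> p x -> p y -> (2 <= count p s)%N.
Proof.
move=> xy xs ys px py; rewrite -size_filter.
apply: (@uniq_leq_size _ [:: x; y]); first by rewrite /= inE xy.
by move=> z; rewrite !inE mem_filter => /orP [/eqP ->|/eqP ->]; rewrite ?px ?py.
Qed.

(** P has no root x >= k, so [k] is a simple eigenvalue, and a second entry at least [k] would be
    another copy of it. As theta >= 0 also differs from [- k], it is a root of P. *)
Lemma lambda2_Bmx (R : realType) (k m : nat) (c theta : R) :
  (2 <= k)%N -> 0 < c -> theta = lambda2 (Bmx k m.+4 c) -> 0 <= theta ->
  [/\ root (ppoly (k%:R - 1) c m) theta,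
      forall x, theta < x -> ~~ root (ppoly (k%:R - 1) c m) x & theta < k%:R].
Proof.
move=> k2 c0 et t0; pose P := ppoly (k%:R - 1) c m.
have k2R : 2 <= k%:R :> R by rewrite (ler_nat _ 2).
have Pk x : k%:R <= x -> ~~ root P x.
  move=> kx; rewrite /root gt_eqF // ppoly_gt0 //; lra.
have P0 : P != 0 by apply: contraNneq (Pk _ (lexx _)) => ->; rewrite root0.
have cpE : char_poly (Bmx k m.+4 c) = ('X - k%:R%:P) * (('X - (- k%:R)%:P) * P).
  by rewrite char_poly_Bmx -/P; move: (k%:R : R) => K; rewrite polyCN polyC_exp; ring.
pose s := real_eigenvalues (Bmx k m.+4 c).
have ms x : (x \in s) = [|| x == k%:R, x == - k%:R | root P x].
  by rewrite mem_real_eigenvalues cpE !rootM !root_XsubC.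
have ck : count_mem k%:R s = 1%N.
  rewrite count_real_eigenvalues cpE mupMl.
    by rewrite -['X - _]expr1 mup_XsubCX eqxx.
  by rewrite rootM root_XsubC negb_or Pk // andbT; apply/eqP; lra.
have ks : k%:R \in s by rewrite ms eqxx.
have nks : - k%:R \in s by rewrite ms eqxx orbT.
have s2 : (1 < size s)%N.
  have := @count_ge2 _ predT k%:R (- k%:R) s; rewrite count_predT; apply=> //.
  by apply/eqP; lra.
have ts : theta \in s by rewrite et; apply: mem_nth.
have tk : theta < k%:R.
  rewrite ltNge; apply/negP => kt.
  have := sorted_real_eigenvalues (Bmx k m.+4 c).
  move: ck s2 et ms; rewrite /lambda2 -/s.
  case: s {ks nks ts} => [|x [|y l]] //= ck _ ey ms /andP [yx _].
  have xs : x = k%:R.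
    have xk : k%:R <= x by rewrite -ey in yx; apply: le_trans yx.
    move: (ms x); rewrite mem_head (negbTE (Pk x xk)) orbF => /esym /orP [/eqP //|/eqP]; lra.
  have ys : y = k%:R.
    move: (ms y); rewrite inE mem_head orbT -ey (negbTE (Pk _ kt)) orbF.
    by move=> /esym /orP [/eqP //|/eqP]; lra.
  by move: ck; rewrite xs ys eqxx.
split=> //.
  by move: ts; rewrite ms => /or3P [/eqP|/eqP|//]; lra.
move=> x tx; apply/negP => rx.
have : lambda2 (Bmx k m.+4 c) <= theta by rewrite et.
rewrite lambda2_le // leqNgt => /negP; apply.
apply: (@count_ge2 _ _ x k%:R) => //; last by rewrite ms rx !orbT.
by apply: contraTneq rx => ->; apply: Pk.
Qed.

Lemma rmorph_horner_gpoly (R S : comNzRingType) (f : {rmorphism R -> S}) (q x : R)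
    (j : nat) :
  f (gpoly q j).[x] = (gpoly (f q) j).[f x].
Proof.
elim/two_step_ind: j => [||j h1 h2].
- by rewrite !horner_gpoly0 rmorph1.
- by rewrite !horner_gpoly1.
by rewrite !horner_gpolySS rmorphB !rmorphM h1 h2.
Qed.

Fixpoint gmx (R : comNzRingType) (n : nat) (q : R) (A : 'M[R]_n) (j : nat) : 'M[R]_n :=
  if j is i.+1 then
    if i is l.+1 then A *m gmx q A i - q *: gmx q A l else A
  else 1%:M.
Arguments gmx : simpl never.

Lemma gmxSS (R : comNzRingType) (n : nat) (q : R) (A : 'M[R]_n) (j : nat) :
  gmx q A j.+2 = A *m gmx q A j.+1 - q *: gmx q A j.
Proof. by []. Qed.

Lemma map_gmx (R S : comNzRingType) (f : {rmorphism R -> S}) (n : nat) (q : R)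
    (A : 'M[R]_n) (j : nat) :
  map_mx f (gmx q A j) = gmx (f q) (map_mx f A) j.
Proof.
elim/two_step_ind: j => [||j h1 h2] //; first exact: map_mx1.
by rewrite !gmxSS map_mxB map_mxM map_mxZ h1 h2.
Qed.

Lemma gmx_diag_conj (F : fieldType) (n : nat) (q : F) (P : 'M[F]_n) (D : 'rV[F]_n)
    (j : nat) : P \in unitmx ->
  gmx q (invmx P *m diag_mx D *m P) j =
    invmx P *m diag_mx (\row_l (gpoly q j).[D 0 l]) *m P.
Proof.
move=> Pu; elim/two_step_ind: j => [||j h1 h2].
- rewrite (_ : diag_mx _ = 1%:M) ?mulmx1 ?mulVmx //.
  by apply/matrixP => i l; rewrite !mxE horner_gpoly0.
- by congr (_ *m diag_mx _ *m _); apply/rowP => l; rewrite mxE horner_gpoly1.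
rewrite gmxSS h1 h2 !mulmxA mulmxK // -[_ *m diag_mx D *m diag_mx _]mulmxA.
rewrite mulmx_diag scalemxAl scalemxAr -mulmxBl -mulmxBr -linearZ -linearB /=.
by congr (_ *m diag_mx _ *m _); apply/rowP => l; rewrite !mxE horner_gpolySS.
Qed.

(** One diagonalization over [R[i]] serves all three claims: [gmx] commutes with conjugation, and
    the identities descend to [R] because the embedding is injective. *)
Lemma symmetric_spectrum (R : rcfType) (n : nat) (q : R) (A : 'M[R]_n) :
  A^T = A -> exists r : 'I_n -> R,
    [/\ char_poly A = \prod_i ('X - (r i)%:P),
        char_poly (- A) = \prod_i ('X - (- r i)%:P)
      & forall i j, \tr (gmx q A i *m gmx q A j) =
          \sum_l (gpoly q i).[r l] * (gpoly q j).[r l]].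
Proof.
move=> /symmetric_diagonalization [P [r [Pu e]]].
exists (fun l => r 0 l); split.
- apply: (@map_poly_inj _ _ (real_complex R)).
  rewrite map_char_poly e char_poly_conj // char_poly_diag rmorph_prod.
  by apply: eq_bigr => i _; rewrite rmorphB /= map_polyX map_polyC mxE.
- apply: (@map_poly_inj _ _ (real_complex R)); rewrite map_char_poly map_mxN e.
  rewrite -mulNmx -mulmxN -raddfN char_poly_conj // char_poly_diag.
  rewrite rmorph_prod; apply: eq_bigr => i _.
  rewrite rmorphB /= map_polyX map_polyC !mxE; congr ('X - _%:P).
  exact/esym/rmorphN.
move=> i j; apply: (fmorph_inj (real_complex R)).
rewrite -trace_map_mx map_mxM !map_gmx e !gmx_diag_conj //.
rewrite !mulmxA mulmxK // -[_ *m diag_mx _ *m diag_mx _]mulmxA mulmx_diag.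
rewrite mxtrace_mulC mulmxA mulmxV // mul1mx mxtrace_diag rmorph_sum.
apply: eq_bigr => l _; rewrite !mxE -!rmorph_horner_gpoly.
exact/esym/rmorphM.
Qed.

(** * Walk counts in regular graphs *)

Lemma gmx_comm (R : comNzRingType) (n : nat) (q : R) (A : 'M[R]_n) (j : nat) :
  A *m gmx q A j = gmx q A j *m A.
Proof.
elim/two_step_ind: j => [||j h1 h2] //; first by rewrite mulmx1 mul1mx.
by rewrite !gmxSS mulmxBr mulmxBl -scalemxAl -scalemxAr h1 -mulmxA -h2.
Qed.

Lemma gmx_sym (R : comNzRingType) (n : nat) (q : R) (A : 'M[R]_n) (j : nat) :
  A^T = A -> (gmx q A j)^T = gmx q A j.
Proof.
move=> sA; elim/two_step_ind: j => [||j h1 h2] //; first exact: trmx1.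
by rewrite gmxSS linearB linearZ /= trmx_mul sA h1 h2 gmx_comm.
Qed.

Section Graph.
Variables (R : realType) (G : sgraph).

Lemma adjacency_sym : (adjacency R G)^T = adjacency R G.
Proof. by apply/matrixP => i j; rewrite !mxE adj_sym. Qed.

Lemma sum_ord_vertex (V : nmodType) (F : 'I_#|G| -> V) :
  \sum_i F i = \sum_(x : G) F (enum_rank x).
Proof. by rewrite (reindex (@enum_rank G)) //; apply: onW_bij; exact: enum_rank_bij. Qed.

(** For q = k - 1 in a k-regular graph this counts the nonbacktracking walks of lengths j, j - 2,
    ... from x to y, by [gwalk_nbw]. *)
Definition gwalk (q : R) (j : nat) (x y : G) : R :=
  gmx q (adjacency R G) j (enum_rank x) (enum_rank y).

Lemma gwalk0 (q : R) (x y : G) : gwalk q 0 x y = (x == y)%:R.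
Proof. by rewrite /gwalk mxE (inj_eq enum_rank_inj). Qed.

Lemma gwalk1 (q : R) (x y : G) : gwalk q 1 x y = (adj x y)%:R.
Proof. by rewrite /gwalk mxE !enum_rankK. Qed.

Lemma sum_adj (F : G -> R) (y : G) :
  \sum_(z | adj y z) F z = \sum_z F z * (adj z y)%:R.
Proof.
rewrite big_mkcond; apply: eq_bigr => z _; rewrite adj_sym.
by case: (adj z y); rewrite ?mulr1 ?mulr0.
Qed.

Lemma gwalkSS (q : R) (j : nat) (x y : G) :
  gwalk q j.+2 x y = \sum_(z | adj y z) gwalk q j.+1 x z - q * gwalk q j x y.
Proof.
rewrite {1}/gwalk gmxSS gmx_comm !mxE sum_ord_vertex sum_adj.
by congr (_ - _); apply: eq_bigr => z _; rewrite mxE !enum_rankK.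
Qed.

Lemma trace_gmx (q : R) (i j : nat) :
  \tr (gmx q (adjacency R G) i *m gmx q (adjacency R G) j) =
    \sum_x \sum_y gwalk q i x y * gwalk q j x y.
Proof.
rewrite /mxtrace sum_ord_vertex; apply: eq_bigr => x _.
rewrite mxE sum_ord_vertex; apply: eq_bigr => y _; congr (_ * _).
by rewrite -[in LHS](gmx_sym q j adjacency_sym) mxE.
Qed.

(* Number of nonbacktracking walks of length j.+1 from x whose last step is
   from z to y. *)
Fixpoint nbwalk (j : nat) (x z y : G) : nat :=
  if adj z y then
    if j is i.+1 then (\sum_(w | w != y) nbwalk i x w z)%N else nat_of_bool (x == z)
  else 0%N.

Lemma nbwalk_nadj (j : nat) (x z y : G) : ~~ adj z y -> nbwalk j x z y = 0%N.
Proof. by case: j => [|j] /= /negbTE ->. Qed.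

Definition nbw (j : nat) (x y : G) : R := \sum_z (nbwalk j x z y)%:R.

Lemma nbw_ge0 (j : nat) (x y : G) : 0 <= nbw j x y.
Proof. by apply: sumr_ge0 => z _; rewrite ler0n. Qed.

Lemma nbw0 (x y : G) : nbw 0 x y = (adj x y)%:R.
Proof.
rewrite /nbw (bigD1 x) //= eqxx big1 ?addr0; first by case: adj.
by move=> z; rewrite eq_sym => /negbTE ->; case: adj.
Qed.

(** Every walk is extended by one step; the subtracted sum removes those whose last two steps go
    from y to z and back. *)
Lemma nbwS (j : nat) (x y : G) :
  nbw j.+1 x y = \sum_(z | adj y z) nbw j x z - \sum_(z | adj y z) (nbwalk j x y z)%:R.
Proof.
rewrite -sumrB [in RHS]big_mkcond; apply: eq_bigr => z _ /=.
rewrite adj_sym; case: ifP => // _.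
rewrite natr_sum /nbw [in RHS](bigD1 y) //=; ring.
Qed.

Variable k : nat.
Hypothesis Greg : regular k G.

Lemma sum_adj_const (y : G) (a : R) : \sum_(z | adj y z) a = k%:R * a.
Proof.
rewrite sumr_const -(Greg y) mulr_natl; congr (_ *+ _).
by apply: eq_card => z; rewrite inE.
Qed.

Lemma nbw1 (x y : G) : nbw 1 x y = gwalk (k%:R - 1) 2 x y - gwalk (k%:R - 1) 0 x y.
Proof.
rewrite nbwS gwalkSS gwalk0.
rewrite (eq_bigr (fun z => gwalk (k%:R - 1) 1 x z)); last first.
  by move=> z _; rewrite gwalk1 nbw0.
rewrite [X in _ - X](eq_bigr (fun z => (x == y)%:R)); last first.
  by move=> z /= ->.
by rewrite sum_adj_const; ring.
Qed.

(** A nonbacktracking walk ending in a step from w to y has k - 1 continuations to some z != w;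
    returning from z to y, these make up the correction term. *)
Lemma nbwSS (j : nat) (x y : G) :
  nbw j.+2 x y = \sum_(z | adj y z) nbw j.+1 x z - (k%:R - 1) * nbw j x y.
Proof.
rewrite nbwS; congr (_ - _).
rewrite (eq_bigr (fun z => \sum_w (w != z)%:R * (nbwalk j x w y)%:R)); last first.
  move=> z /= ->; rewrite natr_sum big_mkcond; apply: eq_bigr => w _.
  by case: (w != z); rewrite ?mul1r ?mul0r.
rewrite exchange_big /nbw mulr_sumr; apply: eq_bigr => w _ /=.
rewrite -mulr_suml; case: (boolP (adj w y)) => wy; last first.
  by rewrite nbwalk_nadj // !mulr0.
congr (_ * _); rewrite (eq_bigr (fun z => 1 - (w == z)%:R)); last first.
  by move=> z _; case: eqP => _ /=; rewrite ?subr0 ?subrr.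
rewrite sumrB sum_adj_const mulr1 (bigD1 w) 1?adj_sym //= eqxx big1 ?addr0 //.
by move=> z /andP [_]; rewrite eq_sym => /negbTE ->.
Qed.

(** [nbw] and the difference of the two [gwalk] values satisfy the same recurrence with the same
    first two values. Integrality, nonnegativity and monotonicity of [gwalk] in steps of two all
    come from this. *)
Lemma gwalk_nbw (j : nat) (x y : G) :
  gwalk (k%:R - 1) j.+2 x y = gwalk (k%:R - 1) j x y + nbw j.+1 x y.
Proof.
suff -> : nbw j.+1 x y = gwalk (k%:R - 1) j.+2 x y - gwalk (k%:R - 1) j x y by ring.
elim/two_step_ind: j y => [||j h1 h2] y; first by rewrite nbw1.
  rewrite nbwSS nbw0 gwalkSS (eq_bigr (fun z => gwalk (k%:R - 1) 2 x z - (x == z)%:R)).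
    rewrite sumrB !gwalk1; suff -> : \sum_(z | adj y z) (x == z)%:R = (adj x y)%:R :> R by ring.
    case: (boolP (adj x y)) => xy.
      rewrite (bigD1 x) 1?adj_sym //= eqxx big1 ?addr0 //.
      by move=> z /andP [_]; rewrite eq_sym => /negbTE ->.
    by rewrite big1 // => z yz; case: eqP => // e; rewrite e adj_sym yz in xy.
  by move=> z _; rewrite nbw1 gwalk0.
rewrite nbwSS h1 (gwalkSS _ j.+2).
rewrite (eq_bigr (fun z => gwalk (k%:R - 1) j.+3 x z - gwalk (k%:R - 1) j.+1 x z)); last first.
  by move=> z _; rewrite h2.
by rewrite sumrB (gwalkSS _ j); ring.
Qed.

Lemma gwalk_natP (j : nat) (x y : G) : exists n : nat, gwalk (k%:R - 1) j x y = n%:R.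
Proof.
elim/two_step_ind: j => [||j [n h1] _].
- by exists (x == y); rewrite gwalk0.
- by exists (adj x y); rewrite gwalk1.
by exists (n + \sum_z nbwalk j.+1 x z y)%N; rewrite gwalk_nbw h1 natrD natr_sum.
Qed.

Lemma gwalk_ge0 (j : nat) (x y : G) : 0 <= gwalk (k%:R - 1) j x y.
Proof. by have [n ->] := gwalk_natP j x y; rewrite ler0n. Qed.

Lemma gwalk_leSS (j : nat) (x y : G) :
  gwalk (k%:R - 1) j x y <= gwalk (k%:R - 1) j.+2 x y.
Proof. by rewrite gwalk_nbw lerDl nbw_ge0. Qed.

Lemma gwalk_le (i j : nat) (x y : G) : (i <= j)%N -> odd i = odd j ->
  gwalk (k%:R - 1) i x y <= gwalk (k%:R - 1) j x y.
Proof.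
move=> ij oij; have -> : j = (i + (j - i)./2.*2)%N by lia.
elim: (_./2) => [|l IHl]; first by rewrite addn0.
by rewrite doubleS !addnS; apply: le_trans IHl (gwalk_leSS _ _ _).
Qed.

Lemma gwalk_row_sum (j : nat) (x : G) :
  \sum_y gwalk (k%:R - 1) j x y = (gpoly (k%:R - 1) j).[k%:R].
Proof.
elim/two_step_ind: j => [||j h1 h2].
- rewrite horner_gpoly0 (bigD1 x) //= gwalk0 eqxx big1 ?addr0 // => y.
  by rewrite eq_sym gwalk0 => /negbTE ->.
- rewrite horner_gpoly1 -[RHS]mulr1 -(sum_adj_const x) [RHS]big_mkcond.
  by apply: eq_bigr => y _; rewrite gwalk1; case: adj.
rewrite horner_gpolySS -h1 -h2 (eq_bigr _ (fun y _ => gwalkSS _ j x y)) sumrB -mulr_sumr.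
congr (_ - _); rewrite (eq_bigr (fun y =>
    \sum_z (if adj y z then gwalk (k%:R - 1) j.+1 x z else 0))); last first.
  by move=> y _; rewrite big_mkcond.
rewrite exchange_big mulr_sumr; apply: eq_bigr => z _ /=.
rewrite -big_mkcond -(sum_adj_const z); apply: eq_bigl => y.
by rewrite adj_sym.
Qed.

Variable side : G -> bool.
Hypothesis Gbip : forall x y : G, adj x y -> side x != side y.

Lemma gwalk_parity (q : R) (j : nat) (x y : G) :
  side x (+) side y != odd j -> gwalk q j x y = 0.
Proof.
elim/two_step_ind: j y => [||j h1 h2] y h.
- by rewrite gwalk0; case: eqP => // e; rewrite e addbb in h.
- by rewrite gwalk1; case: (boolP (adj x y)) => // /Gbip; case: side h; case: side.
rewrite gwalkSS h1 ?mulr0 ?subr0; last by rewrite /= negbK in h.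
rewrite big1 // => z /Gbip yz; apply: h2.
by move: h yz => /=; case: (side x); case: (side y); case: (side z); case: (odd j).
Qed.

Hypothesis k_gt0 : (0 < k)%N.

(** Counting the edges from either side shows that the two sides have equal size. *)
Lemma half_vertices (x : G) (b : bool) :
  2 * \sum_(y | side x (+) side y == b) 1 = #|G|%:R :> R.
Proof.
pose E b' : R := \sum_y \sum_z ((side y == b') && adj y z)%:R.
have e b' : E b' = k%:R * \sum_(y | side y == b') 1.
  rewrite mulr_sumr [RHS]big_mkcond; apply: eq_bigr => y _ /=.
  case: (side y == b') => /=; last by rewrite big1.
  rewrite -(sum_adj_const y) [RHS]big_mkcond; apply: eq_bigr => z _.
  by case: adj.
have h : \sum_(y | side y == true) 1 = \sum_(y | side y == false) 1 :> R.
  apply: (@mulfI _ k%:R); first by rewrite pnatr_eq0 -lt0n.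
  rewrite -!e /E exchange_big; apply: eq_bigr => z _; apply: eq_bigr => y _.
  rewrite (adj_sym z y); case: (boolP (adj y z)) => [/Gbip|]; rewrite ?andbF //.
  by case: (side y); case: (side z).
have -> : #|G|%:R = \sum_(y | side y == true) 1 + \sum_(y | side y == false) 1 :> R.
  rewrite -sum1_card natr_sum (bigID side) /=.
  by congr (_ + _); apply: eq_bigl => y; case: (side y).
have -> : \sum_(y | side x (+) side y == b) 1 = \sum_(y | side y == (side x (+) b)) 1 :> R.
  by apply: eq_bigl => y; case: (side x); case: (side y); case: b.
by case: (side x (+) b); rewrite h; ring.
Qed.
End Graph.

(** * The linear programming bound *)

(** Conjugation by the diagonal matrix with sign +1 on one side and -1 on the other turns A into -
    A. *)
Lemma char_poly_adjacencyN (R : realType) (G : sgraph) : bipartite G ->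
  char_poly (- adjacency R G) = char_poly (adjacency R G).
Proof.
move=> [side Gbip]; pose d : 'rV[R]_#|G| := \row_i (-1) ^+ side (enum_val i).
have dd : diag_mx d *m diag_mx d = 1%:M.
  rewrite mulmx_diag; apply/matrixP => i j; rewrite !mxE.
  by rewrite -expr2 sqrr_sign.
have du : diag_mx d \in unitmx by case: (mulmx1_unit dd).
have h : diag_mx d *m (- adjacency R G) = adjacency R G *m diag_mx d.
  rewrite mul_diag_mx mul_mx_diag; apply/matrixP => i j; rewrite !mxE.
  case: (boolP (adj _ _)) => [/Gbip|_]; last by rewrite oppr0 mulr0 mul0r.
  by case: (side _); case: (side _) => //= _; rewrite !expr0 !expr1; ring.
by rewrite -[RHS](char_poly_conj _ du) -mulmxA -h mulKmx.
Qed.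

Lemma degree_eigenvalue (R : realType) (G : sgraph) (k : nat) : regular k G ->
  (0 < #|G|)%N -> root (char_poly (adjacency R G)) k%:R.
Proof.
move=> Greg G0; rewrite -eigenvalue_root_char; apply/eigenvalueP.
exists (const_mx 1); last first.
  apply/eqP => /rowP/(_ (Ordinal G0)) /eqP; rewrite !mxE; apply/negP; exact: oner_neq0.
apply/rowP => j; rewrite !mxE sum_ord_vertex mulr1 -[RHS]mulr1.
rewrite -(sum_adj_const Greg (enum_val j)) [RHS]big_mkcond.
apply: eq_bigr => x _; rewrite !mxE enum_rankK mul1r adj_sym.
by case: adj.
Qed.

Lemma perm_eq_roots (R : fieldType) (s t : seq R) :
  \prod_(x <- s) ('X - x%:P) = \prod_(x <- t) ('X - x%:P) -> perm_eq s t.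
Proof.
by move=> e; apply/allP => x _ /=; rewrite -!mu_prod_XsubC e.
Qed.

Definition pwalk (R : realType) (G : sgraph) (q c : R) (m : nat) (x y : G) : R :=
  gwalk q m.+2 x y + (c - 1) * gwalk q m x y.

(** [r] lists the eigenvalues with multiplicity, and [i0], [i1] single out one occurrence each of
    [k] and [- k]; other indices may carry these values too. *)
Record spectrum (R : realType) (G : sgraph) (k : nat) (r : 'I_#|G| -> R)
    (i0 i1 : 'I_#|G|) : Prop := Spectrum {
  spec_neq : i0 != i1;
  spec_max : r i0 = k%:R;
  spec_min : r i1 = - k%:R;
  spec_perm : perm_eq (real_eigenvalues (adjacency R G)) (codom r);
  spec_opp : perm_eq (codom r) (codom (fun i => - r i));
  spec_trace : forall i j,
    \sum_(x : G) \sum_(y : G) gwalk (k%:R - 1) i x y * gwalk (k%:R - 1) j x y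
    = \sum_l (gpoly (k%:R - 1) i).[r l] * (gpoly (k%:R - 1) j).[r l]
}.

Lemma exists_spectrum (R : realType) (G : sgraph) (k : nat) :
  regular k G -> bipartite G -> (0 < #|G|)%N -> (0 < k)%N ->
  exists (r : 'I_#|G| -> R) (i0 i1 : 'I_#|G|), spectrum k r i0 i1.
Proof.
move=> Greg Gbip G0 k0.
have [r [e eN tr]] := symmetric_spectrum (k%:R - 1) (adjacency_sym R G).
have e' : char_poly (adjacency R G) = \prod_(x <- codom r) ('X - x%:P).
  by rewrite e big_image.
have eN' : char_poly (- adjacency R G) = \prod_(x <- codom (fun i => - r i)) ('X - x%:P).
  by rewrite eN big_image.
have pm : perm_eq (real_eigenvalues (adjacency R G)) (codom r).
  by apply/allP => x _ /=; rewrite count_real_eigenvalues e' mu_prod_XsubC.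
have po : perm_eq (codom r) (codom (fun i => - r i)).
  by apply: perm_eq_roots; rewrite -e' -eN' char_poly_adjacencyN.
have kr : k%:R \in codom r.
  by rewrite -(perm_mem pm) mem_real_eigenvalues degree_eigenvalue.
have /codomP [i0 e0] := kr.
have /codomP [i1 e1] : k%:R \in codom (fun i => - r i) by rewrite -(perm_mem po).
exists r, i0, i1; split=> //; last by move=> i j; rewrite -trace_gmx.
- apply/eqP => e01; move: e1; rewrite -e01 -e0 => /eqP; rewrite -subr_eq0 opprK.
  by rewrite -natrD pnatr_eq0; lia.
- by rewrite e1 opprK.
Qed.

Section Spectrum.
Variables (R : realType) (G : sgraph) (k : nat) (r : 'I_#|G| -> R) (i0 i1 : 'I_#|G|).
Hypothesis rS : spectrum k r i0 i1.

(** At most one eigenvalue exceeds theta, and [i0] already gives one; by symmetry of the spectrum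
    the same holds for [- r] with [i1]. Together they bound the absolute value. *)
Lemma spectrum_le (theta : R) : 0 <= theta -> theta < k%:R ->
  lambda2 (adjacency R G) <= theta ->
  forall i, i != i0 -> i != i1 -> `|r i| <= theta.
Proof.
case: rS => i01 e0 e1 pm po _ t0 tk; rewrite lambda2_le // => h.
have h1 : (count (fun x => theta < x)%R (codom r) <= 1)%N.
  by rewrite -(permP pm).
have h2 : (count (fun x => theta < x)%R (codom (fun i => - r i)) <= 1)%N.
  by rewrite -(permP po).
move=> i n0 n1; rewrite ler_norml; apply/andP; split; rewrite leNgt; apply/negP => hi.
- move: h2; rewrite leqNgt => /negP; apply; rewrite count_map.
  apply: (@count_ge2 _ _ i i1); rewrite ?mem_enum //= ?e1 ?opprK //; lra.
- move: h1; rewrite leqNgt => /negP; apply; rewrite count_map.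
  by apply: (@count_ge2 _ _ i i0); rewrite ?mem_enum //= ?e0.
Qed.

Lemma lambda2_le_spectrum (theta : R) : 0 <= theta ->
  (forall i, i != i0 -> i != i1 -> r i <= theta) ->
  lambda2 (adjacency R G) <= theta.
Proof.
case: rS => i01 e0 e1 pm po _ t0 h; rewrite lambda2_le // (permP pm) count_map.
rewrite -size_filter; set s := filter _ _.
apply: (@uniq_leq_size _ s [:: i0]); first by rewrite filter_uniq // enum_uniq.
move=> i; rewrite mem_filter inE => /andP [/= ti _].
case: (eqVneq i i0) => [->|n0]; rewrite ?mem_head //.
have k0 : 0 <= k%:R :> R by rewrite ler0n.
case: (eqVneq i i1) ti => [->|n1]; first by rewrite e1 => ?; lra.
by move=> ti; have := h i n0 n1; rewrite leNgt ti.
Qed.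

Lemma sum_spectrum (F : R -> R) :
  \sum_l F (r l) = F k%:R + F (- k%:R) + \sum_(l | (l != i0) && (l != i1)) F (r l).
Proof.
case: rS => i01 e0 e1 _ _ _; rewrite (bigD1 i0) //= (bigD1 i1) 1?eq_sym //=.
by rewrite e0 e1 addrA.
Qed.

Lemma pwalk_gwalk_trace (c : R) (m j : nat) :
  \sum_(x : G) \sum_(y : G) pwalk (k%:R - 1) c m x y * gwalk (k%:R - 1) j x y
  = \sum_l (ppoly (k%:R - 1) c m).[r l] * (gpoly (k%:R - 1) j).[r l].
Proof.
transitivity (\sum_(x : G) \sum_(y : G) gwalk (k%:R - 1) m.+2 x y * gwalk (k%:R - 1) j x y
  + (c - 1) * \sum_(x : G) \sum_y gwalk (k%:R - 1) m x y * gwalk (k%:R - 1) j x y).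
  rewrite mulr_sumr -big_split; apply: eq_bigr => x _ /=.
  by rewrite mulr_sumr -big_split; apply: eq_bigr => y _ /=; rewrite /pwalk; ring.
rewrite !(spec_trace rS) mulr_sumr -big_split; apply: eq_bigr => l _ /=.
by rewrite horner_ppoly; ring.
Qed.

Lemma pwalk_sqr_trace (c : R) (m : nat) :
  \sum_(x : G) \sum_y pwalk (k%:R - 1) c m x y ^+ 2
  = \sum_l (ppoly (k%:R - 1) c m).[r l] ^+ 2.
Proof.
transitivity (\sum_(x : G) \sum_y pwalk (k%:R - 1) c m x y * gwalk (k%:R - 1) m.+2 x y
  + (c - 1) * \sum_(x : G) \sum_y pwalk (k%:R - 1) c m x y * gwalk (k%:R - 1) m x y).
  rewrite mulr_sumr -big_split; apply: eq_bigr => x _ /=.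
  by rewrite mulr_sumr -big_split; apply: eq_bigr => y _ /=; rewrite /pwalk; ring.
rewrite !pwalk_gwalk_trace mulr_sumr -big_split; apply: eq_bigr => l _ /=.
by rewrite (horner_ppoly _ c); ring.
Qed.
End Spectrum.

Lemma sum_pwalk (R : realType) (G : sgraph) (k m : nat) (c : R) (x : G) :
  regular k G ->
  \sum_y pwalk (k%:R - 1) c m x y = (ppoly (k%:R - 1) c m).[k%:R].
Proof.
move=> Greg; rewrite horner_ppoly -!(gwalk_row_sum R Greg _ x) mulr_sumr -big_split.
by [].
Qed.

Lemma sum_const_vertex (R : realType) (G : sgraph) (a : R) :
  \sum_(x : G) a = #|G|%:R * a.
Proof. by rewrite sumr_const mulr_natl; congr (_ *+ _); apply: eq_card. Qed.

Section Bound.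
Variables (R : realType) (G : sgraph) (k m : nat) (c : R) (side : G -> bool).
Hypothesis Greg : regular k G.
Hypothesis Gbip : forall x y : G, adj x y -> side x != side y.
Hypothesis G0 : (0 < #|G|)%N.
Hypothesis k2 : (2 <= k)%N.
Hypothesis c0 : 0 < c.
Notation q := (k%:R - 1).
Notation P := (ppoly (k%:R - 1) c m).

(** P(A) is supported on the pairs of parity m; each row has |G| / 2 such pairs and sum P(k). The
    right side is 0 once tr P(A)^2 = 2 P(k)^2 and c |G| = 2 P(k). *)
Lemma sum_pwalk_sub_sqr :
  \sum_x \sum_(y | side x (+) side y == odd m) (pwalk q c m x y - c) ^+ 2
  = \sum_(x : G) \sum_y pwalk q c m x y ^+ 2
    - 2 * c * (#|G|%:R * P.[k%:R]) + c ^+ 2 * #|G|%:R ^+ 2 / 2.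
Proof.
have pz (x y : G) : side x (+) side y != odd m -> pwalk q c m x y = 0.
  by move=> h; rewrite /pwalk !(gwalk_parity Gbip) ?mulr0 ?addr0 //= negbK.
have k0 : (0 < k)%N by exact: ltnW.
have onp (x : G) (F : G -> R) : (forall y, side x (+) side y != odd m -> F y = 0) ->
    \sum_y F y = \sum_(y | side x (+) side y == odd m) F y.
  move=> hF; rewrite (bigID (fun y => side x (+) side y == odd m)) /=.
  by rewrite [X in _ + X]big1 ?addr0.
have e (x : G) : \sum_(y | side x (+) side y == odd m) (pwalk q c m x y - c) ^+ 2
   = \sum_y pwalk q c m x y ^+ 2 - 2 * c * P.[k%:R] + c ^+ 2 * (#|G|%:R / 2).
  have -> : #|G|%:R / 2 = \sum_(y | side x (+) side y == odd m) 1 :> R.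
    rewrite -(half_vertices R Greg Gbip k0 x (odd m)); lra.
  rewrite -(sum_pwalk m c x Greg) (onp x (fun y => pwalk q c m x y)); last exact: pz.
  rewrite (onp x (fun y => pwalk q c m x y ^+ 2)); last by move=> y h; rewrite pz // expr0n.
  rewrite !mulr_sumr -sumrB -big_split; apply: eq_bigr => y _ /=; ring.
rewrite (eq_bigr _ (fun x _ => e x)) big_split sumrB /= !sum_const_vertex.
by field.
Qed.

Lemma moore_bound (theta : R) : 0 <= theta -> theta < k%:R ->
  root P theta -> (forall x, theta < x -> ~~ root P x) ->
  lambda2 (adjacency R G) <= theta ->
  c * #|G|%:R <= 2 * P.[k%:R] /\
  (c * #|G|%:R = 2 * P.[k%:R] ->
    forall x y, side x (+) side y = odd m -> pwalk q c m x y = c).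
Proof.
move=> t0 tk rt nr l2.
have c0' := c0.
have k2R : 2 <= k%:R :> R by rewrite (ler_nat _ 2).
have q1 : 1 <= q :> R by lra.
have [r [i0 [i1 rS]]] := exists_spectrum R Greg (ex_intro _ side Gbip) G0 (ltnW k2).
have [a] := lp_certificate q1 c0 t0 rt nr; set g := fun x => _ => /= -[a0 apar g0 Pg PgP].
rewrite (_ : q + 1 = k%:R) in g0; last by ring.
(* [T] is tr (P(A) g(A)), estimated from below entrywise and from above through the spectrum. *)
pose T : R := \sum_(x : G) \sum_(y : G) pwalk q c m x y * \sum_(j < m.+1) a j * gwalk q j x y.
have TE : T = \sum_l P.[r l] * g (r l).
  transitivity (\sum_(j < m.+1) a j * \sum_(x : G) \sum_y pwalk q c m x y * gwalk q j x y).
    rewrite /T; under eq_bigr => x _ do under eq_bigr => y _ do rewrite mulr_sumr.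
    under eq_bigr => x _ do rewrite exchange_big.
    rewrite exchange_big; apply: eq_bigr => j _ /=.
    rewrite mulr_sumr; apply: eq_bigr => x _; rewrite mulr_sumr.
    by apply: eq_bigr => y _; ring.
  under eq_bigr => j _ do rewrite (pwalk_gwalk_trace rS) mulr_sumr.
  rewrite exchange_big; apply: eq_bigr => l _ /=; rewrite mulr_sumr.
  by apply: eq_bigr => j _; ring.
have lower : c * #|G|%:R * g k%:R <= T.
  have -> : c * #|G|%:R * g k%:R =
     \sum_(x : G) \sum_y c * \sum_(j < m.+1) a j * gwalk q j x y.
    rewrite [c * _]mulrC -mulrA -sum_const_vertex; apply: eq_bigr => x _.
    rewrite -mulr_sumr; congr (_ * _); rewrite exchange_big; apply: eq_bigr => j _ /=.
    by rewrite -mulr_sumr (gwalk_row_sum R Greg).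
  apply: ler_sum => x _; apply: ler_sum => y _; rewrite !mulr_sumr.
  apply: ler_sum => j _.
  have [ej|nj] := eqVneq (odd j) (odd m); last by rewrite apar // !mul0r !mulr0.
  rewrite ![_ * (a j * _)]mulrCA; apply: ler_wpM2l; first exact: a0.
  have [n en] := gwalk_natP R Greg j x y.
  have h1 : gwalk q j x y <= gwalk q m x y :> R.
    by apply: gwalk_le => //; rewrite -ltnS.
  have h2 := gwalk_leSS R Greg m x y.
  have h3 : c * gwalk q j x y <= pwalk q c m x y by rewrite /pwalk; nra.
  (* The entry n of G_j(A) is a natural number: it is 0, or n >= 1 and the entry p of P(A) satisfies
     p n >= c n^2 >= c n. *)
  case: n en => [->|n en]; first by rewrite !mulr0.
  apply: le_trans (ler_wpM2r _ h3); last by rewrite en ler0n.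
  have : 1 <= gwalk q j x y :> R by rewrite en (ler_nat _ 1).
  move=> h4; rewrite -mulrA; apply: ler_wpM2l; first exact: ltW.
  by apply: ler_peMr => //; lra.
(* P and g have the parity of m, so the eigenvalues k and - k contribute equally. *)
have gN : P.[- k%:R] * g (- k%:R) = P.[k%:R] * g k%:R.
  rewrite ppolyN /g !mulr_sumr; apply: eq_bigr => j _; rewrite gpolyN.
  have [ej|nj] := eqVneq (odd j) (odd m); last by rewrite apar // !mul0r !mulr0.
  rewrite -(signr_odd _ j) -(signr_odd _ m) ej; case: (odd m); rewrite ?expr0 ?expr1; ring.
have Tsum := sum_spectrum rS (fun x => P.[x] * g x).
have neg l : (l != i0) && (l != i1) -> P.[r l] * g (r l) <= 0.
  by move=> /andP [n0 n1]; apply: Pg; apply: (spectrum_le rS t0 tk l2).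
have rest : \sum_(l | (l != i0) && (l != i1)) P.[r l] * g (r l) <= 0 by exact: sumr_le0.
split.
  have : c * #|G|%:R * g k%:R <= 2 * P.[k%:R] * g k%:R.
    by apply: le_trans lower _; rewrite TE Tsum gN; lra.
  by rewrite ler_pM2r.
move=> eqv.
have rest0 : \sum_(l | (l != i0) && (l != i1)) P.[r l] * g (r l) = 0.
  apply/eqP; rewrite eq_le rest /=; move: lower; rewrite eqv TE Tsum gN; lra.
have Pr0 l : (l != i0) && (l != i1) -> P.[r l] = 0.
  move=> hl; apply/rootP/PgP; move/eqP: rest0.
  rewrite -oppr_eq0 -sumrN psumr_eq0; last by move=> i /neg; rewrite oppr_ge0.
  by move/allP/(_ l (mem_index_enum _)); rewrite hl /= oppr_eq0 => /eqP.
have sq : \sum_(x : G) \sum_y pwalk q c m x y ^+ 2 = 2 * P.[k%:R] ^+ 2.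
  rewrite (pwalk_sqr_trace rS) (sum_spectrum rS (fun x => P.[x] ^+ 2)).
  rewrite big1 ?addr0; last by move=> l /Pr0 ->; rewrite expr0n.
  rewrite ppolyN exprMn -exprM mulnC exprM sqrrN expr1n expr1n mul1r; ring.
have z := sum_pwalk_sub_sqr; rewrite sq in z.
have z0 : \sum_x \sum_(y | side x (+) side y == odd m) (pwalk q c m x y - c) ^+ 2 = 0.
  rewrite z; have -> : c ^+ 2 * #|G|%:R ^+ 2 / 2 = (c * #|G|%:R) ^+ 2 / 2 by field.
  have -> : 2 * c * (#|G|%:R * P.[k%:R]) = 2 * (c * #|G|%:R) * P.[k%:R] by ring.
  by rewrite eqv; field.
move=> x y hxy; apply/eqP; rewrite -subr_eq0 -sqrf_eq0.
move/eqP: z0; rewrite psumr_eq0; last first.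
  by move=> i _; apply: sumr_ge0 => j _; exact: sqr_ge0.
move/allP/(_ x (mem_index_enum _)) => /=; rewrite psumr_eq0; last first.
  by move=> j _; exact: sqr_ge0.
by move/allP/(_ y (mem_index_enum _)); rewrite hxy eqxx.
Qed.

(** Here tr P(A)^2 = c^2 |G|^2 / 2 = 2 P(k)^2 is exhausted by one occurrence each of k and - k, so P
    vanishes at all other eigenvalues; these cannot exceed theta. *)
Lemma pwalk_const_spectrum (theta : R) : 0 <= theta ->
  (forall x, theta < x -> ~~ root P x) ->
  (forall x y, side x (+) side y = odd m -> pwalk q c m x y = c) ->
  c * #|G|%:R = 2 * P.[k%:R] /\ lambda2 (adjacency R G) <= theta.
Proof.
move=> t0 nr hP.
have k0 : (0 < k)%N by exact: ltnW.
have pz (x y : G) : side x (+) side y != odd m -> pwalk q c m x y = 0.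
  by move=> h; rewrite /pwalk !(gwalk_parity Gbip) ?mulr0 ?addr0 //= negbK.
have [r [i0 [i1 rS]]] := exists_spectrum R Greg (ex_intro _ side Gbip) G0 k0.
have [x0 _] : exists x0 : G, x0 \in G by apply/card_gt0P.
have row (f : R -> R) (x : G) : f 0 = 0 -> \sum_y f (pwalk q c m x y) = #|G|%:R / 2 * f c.
  move=> f0; rewrite (bigID (fun y => side x (+) side y == odd m)) /=.
  rewrite [X in _ + X]big1 ?addr0; last by move=> y /pz ->.
  rewrite (eq_bigr (fun=> 1 * f c)); last by move=> y /eqP /hP ->; rewrite mul1r.
  rewrite -mulr_suml; congr (_ * _).
  by rewrite -(half_vertices R Greg Gbip k0 x (odd m)); lra.
have e1 : c * #|G|%:R = 2 * P.[k%:R].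
  by rewrite -(sum_pwalk m c x0 Greg) (row id) //; field.
split=> //; apply: (lambda2_le_spectrum rS) => // i n0 n1.
have := pwalk_sqr_trace rS c m.
rewrite (eq_bigr _ (fun x _ => row (fun z => z ^+ 2) x (expr0n _ 2))).
rewrite sum_const_vertex (sum_spectrum rS (fun x => P.[x] ^+ 2)).
rewrite ppolyN exprMn -exprM mulnC exprM sqrrN expr1n expr1n mul1r.
have -> : #|G|%:R * (#|G|%:R / 2 * c ^+ 2) = P.[k%:R] ^+ 2 + P.[k%:R] ^+ 2.
  have -> : #|G|%:R * (#|G|%:R / 2 * c ^+ 2) = (c * #|G|%:R) ^+ 2 / 2 by field.
  by rewrite e1; field.
move=> e2; have {e2} /eqP : \sum_(l | (l != i0) && (l != i1)) P.[r l] ^+ 2 = 0 by lra.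
rewrite psumr_eq0; last by move=> j _; exact: sqr_ge0.
move/allP/(_ i (mem_index_enum _)); rewrite n0 n1 /= sqrf_eq0 => ri.
by rewrite leNgt; apply/negP => /nr /negP; apply.
Qed.
End Bound.

(** * Distances and intersection numbers *)

Lemma walkP (G : sgraph) (n : nat) (x y : G) :
  reflect (exists2 p, size p = n & path (@adj G) x p && (last x p == y)) (walk n x y).
Proof.
apply: (iffP existsP) => [[p h]|[p sp h]]; first by exists p; rewrite ?size_tuple.
by move/eqP: sp => sp; exists (Tuple sp).
Qed.

Lemma walk0 (G : sgraph) (x y : G) : walk 0 x y = (x == y).
Proof.
apply/walkP/idP => [[p /size0nil ->] //|h]; by exists [::].
Qed.

Lemma walkS (G : sgraph) (n : nat) (x y : G) :
  walk n.+1 x y = [exists z, walk n x z && adj z y].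
Proof.
apply/walkP/existsP => [[p]|[z /andP [/walkP [p sp /andP [pp /eqP lp]] zy]]].
  case: (lastP p) => // p' a; rewrite size_rcons last_rcons rcons_path => -[sp].
  move=> /andP [/andP [pp pa] /eqP <-]; exists (last x p'); rewrite pa andbT.
  by apply/walkP; exists p'; rewrite // pp eqxx.
by exists (rcons p y); rewrite ?size_rcons ?sp // rcons_path pp lp zy last_rcons eqxx.
Qed.

Lemma walk_adj (G : sgraph) (n : nat) (x y z : G) :
  walk n x y -> adj y z -> walk n.+1 x z.
Proof. by move=> h yz; rewrite walkS; apply/existsP; exists y; rewrite h. Qed.

Section Distance.
Variable G : sgraph.
Hypothesis Gconn : connected G.

(** Removing repetitions from a path makes its length less than [#|G|], the range searched by
    [gdist]. *)
Lemma walk_exists (x y : G) : exists2 n, (n < #|G|)%N & walk n x y.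
Proof.
have /connectP [p pp ey] := Gconn.2 x y.
case: (shortenP pp) ey => p' pp' up' _ ey.
exists (size p').
  have : (size (x :: p') <= #|G|)%N.
    by rewrite -(card_uniqP up'); exact: max_card.
  by [].
by apply/existsP; exists (in_tuple p'); rewrite /= pp' -ey eqxx.
Qed.

Lemma gdistP (x y : G) : walk (gdist x y) x y /\ forall n, walk n x y -> (gdist x y <= n)%N.
Proof.
have [n0 ln w0] := walk_exists x y.
have h : has (fun n => walk n x y) (iota 0 #|G|).
  by apply/hasP; exists n0; rewrite ?mem_iota.
have lt : (gdist x y < #|G|)%N by rewrite -[X in (_ < X)%N](size_iota 0) -has_find.
split; first by have := nth_find 0%N h; rewrite nth_iota.
move=> n w; rewrite leqNgt; apply/negP => ln'.
have := before_find 0%N ln'; rewrite nth_iota ?add0n ?w //.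
exact: ltn_trans ln' lt.
Qed.

Lemma gdist_walk (x y : G) : walk (gdist x y) x y.
Proof. by have [] := gdistP x y. Qed.

Lemma gdist_le (x y : G) (n : nat) : walk n x y -> (gdist x y <= n)%N.
Proof. by have [_ ] := gdistP x y; apply. Qed.

Lemma gdistxx (x : G) : gdist x x = 0%N.
Proof. by apply/eqP; rewrite -leqn0; apply: gdist_le; rewrite walk0. Qed.

Lemma gdist_eq0 (x y : G) : gdist x y = 0%N -> x = y.
Proof. by move=> e; have := gdist_walk x y; rewrite e walk0 => /eqP. Qed.

Lemma gdist_pred (x y : G) (d : nat) : gdist x y = d.+1 ->
  exists2 z, adj y z & gdist x z = d.
Proof.
move=> e; have := gdist_walk x y; rewrite e walkS => /existsP [z /andP [w zy]].
exists z; first by rewrite adj_sym.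
apply/eqP; rewrite eqn_leq (gdist_le w) /= -ltnS -e; apply: gdist_le.
exact: walk_adj (gdist_walk x z) zy.
Qed.

Lemma gdist_descend (x y : G) (j : nat) : (j <= gdist x y)%N -> exists z, gdist x z = j.
Proof.
move=> le; have [d] : exists d, gdist x y = (j + d)%N by exists (gdist x y - j)%N; lia.
elim: d y {le} => [|d IHd] y; first by rewrite addn0; exists y.
by rewrite addnS => /gdist_pred [z _ /IHd].
Qed.

Variable side : G -> bool.
Hypothesis Gbip : forall x y : G, adj x y -> side x != side y.

Lemma walk_parity (n : nat) (x y : G) : walk n x y -> side x (+) side y = odd n.
Proof.
elim: n y => [|n IHn] y; first by rewrite walk0 => /eqP ->; rewrite addbb.
rewrite walkS => /existsP [z /andP [/IHn h /Gbip]] /=; rewrite -h.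
by case: (side x); case: (side y); case: (side z).
Qed.

Lemma gdist_parity (x y : G) : odd (gdist x y) = side x (+) side y.
Proof. by rewrite (walk_parity (gdist_walk x y)). Qed.

Lemma gdist_adj (x y z : G) : adj y z ->
  gdist x z = (gdist x y).+1 \/ (gdist x z).+1 = gdist x y.
Proof.
move=> yz.
have h1 : (gdist x z <= (gdist x y).+1)%N by apply/gdist_le/walk_adj/yz/gdist_walk.
have h2 : (gdist x y <= (gdist x z).+1)%N.
  by apply/gdist_le/(walk_adj (gdist_walk x z)); rewrite adj_sym.
have : odd (gdist x z) != odd (gdist x y).
  rewrite !gdist_parity; have := Gbip yz.
  by case: (side x); case: (side y); case: (side z).
by lia.
Qed.

Variable k : nat.
Hypothesis Greg : regular k G.

Lemma nbrs_at_far (x y : G) (j : nat) : j <> (gdist x y).+1 -> j.+1 <> gdist x y ->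
  nbrs_at x y j = 0%N.
Proof.
move=> h1 h2; apply: eq_card0 => z; rewrite inE; apply/negbTE/negP.
by move=> /andP [/gdist_adj - /(_ x) h /eqP e]; case: h => h; lia.
Qed.

Lemma nbrs_at_root (x : G) : nbrs_at x x 1 = k.
Proof.
rewrite -(Greg x); apply: eq_card => z; rewrite !inE.
case: (boolP (adj x z)) => // xz; have := gdist_adj x xz.
by rewrite gdistxx; case=> [->|].
Qed.

Lemma nbrs_at_sum (x y : G) (d : nat) : gdist x y = d.+1 ->
  (nbrs_at x y d + nbrs_at x y d.+2)%N = k.
Proof.
move=> e; rewrite -(Greg y) -[RHS](cardsID [set z | gdist x z == d]).
congr (_ + _)%N; apply: eq_card => z; rewrite !inE //.
case: (boolP (adj y z)) => [yz|_]; rewrite ?andbF //=.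
have := gdist_adj x yz; rewrite andbT e; lia.
Qed.

Lemma gdist_step (y : G) : (0 < k)%N -> exists z, adj y z.
Proof.
move=> k0; have : (0 < #|[set z | adj y z]|)%N by rewrite Greg.
by move/card_gt0P => [z]; rewrite inE => yz; exists z.
Qed.
End Distance.

(** * Walk counts and intersection numbers in the extremal case *)

Section Moore.
Variables (R : realType) (G : sgraph) (k m : nat) (c : R) (side : G -> bool).
Hypothesis Gconn : connected G.
Hypothesis Greg : regular k G.
Hypothesis Gbip : forall x y : G, adj x y -> side x != side y.
Hypothesis k2 : (2 <= k)%N.
Hypothesis c0 : 0 < c.
Notation q := (k%:R - 1 : R).

Lemma q_ge1 : 1 <= q.
Proof. have : 2 <= k%:R :> R by rewrite (ler_nat _ 2). lra. Qed.

(** G_n(A) and A^n have the same support. This gives [walk] the monotonicity of [gwalk], hence the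
    description by distance and parity in [walk_gdist]. *)
Lemma walk_gwalk (n : nat) (x y : G) : walk n x y = (0 < gwalk q n x y).
Proof.
elim/two_step_ind: n y => [||n h1 h2] y.
- by rewrite walk0 gwalk0; case: eqP; rewrite ?ltr01 ?ltxx.
- rewrite walkS gwalk1 ltr0n lt0b; apply/existsP/idP => [[z]|xy].
    by rewrite walk0 => /andP [/eqP ->].
  by exists x; rewrite walk0 eqxx.
have q1 := q_ge1.
have le := gwalk_leSS R Greg n x y.
have g0 j z := gwalk_ge0 R Greg j x z.
rewrite walkS; apply/existsP/idP => [[z /andP [w zy]]|h].
  have : 0 < \sum_(z | adj y z) gwalk q n.+1 x z.
    rewrite (bigD1 z) 1?adj_sym //=; apply: ltr_wpDr; last by rewrite -h2.
    by apply: sumr_ge0 => t _; exact: g0.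
  (* The sum equals G_(n+2) + q G_n, which is at most (1 + q) G_(n+2) by monotonicity. *)
  have := gwalkSS q n x y; have := g0 n y; nra.
apply/existsP; apply: contraLR h => /existsPn nw.
rewrite -leNgt gwalkSS big1 ?sub0r ?oppr_le0 ?mulr_ge0 //; first by lra.
move=> z yz; have := nw z; rewrite h2 adj_sym yz andbT -leNgt => h3.
by apply/eqP; rewrite eq_le h3 g0.
Qed.

Lemma walk_gdist (n : nat) (x y : G) :
  walk n x y = (gdist x y <= n)%N && (odd (gdist x y) == odd n).
Proof.
apply/idP/andP => [w|[le /eqP op]].
  by rewrite (gdist_le Gconn w) (gdist_parity Gconn Gbip) (walk_parity Gbip w).
move: (gdist_walk Gconn x y); rewrite !walk_gwalk => h; apply: lt_le_trans h _.
exact: gwalk_le.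
Qed.

(** In terms of intersection numbers: diameter at most m + 3, c_i = 1 for 1 <= i <= m + 1, and
    c_(m+2) = c, stated pair by pair. *)
Definition moore_distances : Prop := forall x y : G,
  [/\ (gdist x y <= m.+3)%N,
      (0 < gdist x y <= m.+1)%N -> nbrs_at x y (gdist x y).-1 = 1%N
    & gdist x y = m.+2 -> (nbrs_at x y m.+1)%:R = c].

Lemma nbrs_at_real (x y : G) (j : nat) :
  (nbrs_at x y j)%:R = \sum_(z | adj y z) (gdist x z == j)%:R :> R.
Proof.
rewrite /nbrs_at -sum1_card natr_sum big_mkcond [RHS]big_mkcond.
by apply: eq_bigr => z _; rewrite inE; case: adj; case: eqP.
Qed.

Lemma gwalk_indicator (j : nat) (x y : G) : gwalk q j x y <= 1 ->
  gwalk q j x y = ((gdist x y <= j)%N && (odd (gdist x y) == odd j))%:R.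
Proof.
rewrite -walk_gdist walk_gwalk; have [[|[|n]] ->] := gwalk_natP R Greg j x y.
- by rewrite ltxx.
- by rewrite ltr01.
by rewrite -[1]/(1%:R) ler_nat.
Qed.

Lemma sum_indicator (j d : nat) (x y : G) : gdist x y = d.+1 -> (j = d \/ j = d.+1) ->
  odd j = odd d ->
  (nbrs_at x y d)%:R = \sum_(z | adj y z)
     ((gdist x z <= j)%N && (odd (gdist x z) == odd j))%:R :> R.
Proof.
move=> e hj oj; rewrite nbrs_at_real; apply: eq_bigr => z /(gdist_adj Gconn Gbip x).
rewrite e => h; congr (nat_of_bool _)%:R; lia.
Qed.

(** By induction G_j(A) with j <= m + 1 is the 0-1 indicator of distance at most j and of parity j;
    one more step of the recurrence gives P(A). *)
Lemma moore_distances_pwalk : moore_distances ->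
  forall x y, side x (+) side y = odd m -> pwalk q c m x y = c.
Proof.
move=> md.
have ind j : (j <= m.+1)%N -> forall x y : G,
    gwalk q j x y = ((gdist x y <= j)%N && (odd (gdist x y) == odd j))%:R.
  elim/two_step_ind: j => [||j h1 h2] jm x y.
  - rewrite gwalk0 -walk_gdist walk0 //.
  - rewrite gwalk1 -walk_gdist walkS; congr (nat_of_bool _)%:R.
    apply/idP/existsP => [xy|[z]]; last by rewrite walk0 => /andP [/eqP ->].
    by exists x; rewrite walk0 eqxx.
  have [ep|np] := eqVneq (side x (+) side y) (odd j); last first.
    rewrite (gwalk_parity Gbip) ?(gdist_parity Gconn Gbip) /= ?negbK //.
    by rewrite (negbTE np) andbF.
  rewrite gwalkSS (eq_bigr _ (fun z _ => h2 _ x z)) ?h1 //; [|lia|lia].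
  have pd : odd (gdist x y) = odd j by rewrite (gdist_parity Gconn Gbip).
  rewrite pd /= negbK eqxx !andbT.
  have [le|gt] := leqP (gdist x y) j.
    (* All k neighbours lie within distance j + 1, and k - (k - 1) = 1. *)
    rewrite (eq_bigr (fun z => 1)); last first.
      move=> z /(gdist_adj Gconn Gbip x) h.
      by rewrite (_ : _ && _ = true) //; lia.
    rewrite (sum_adj_const Greg) (_ : (gdist x y <= j.+2)%N = true); last by lia.
    by rewrite /=; ring.
  rewrite mulr0 subr0.
  have [e|ne] := eqVneq (gdist x y) j.+2.
    rewrite -(@sum_indicator j.+1 j.+1) // ?e ?leqnn; [|by left].
    have [_ h _] := md x y; rewrite e /= in h; rewrite h //; lia.
  rewrite (_ : (gdist x y <= j.+2)%N = false); last by lia.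
  rewrite big1 // => z /(gdist_adj Gconn Gbip x) h.
  by rewrite (_ : _ && _ = false) //; lia.
move=> x y hxy.
have pd : odd (gdist x y) = odd m by rewrite (gdist_parity Gconn Gbip).
rewrite /pwalk gwalkSS (eq_bigr _ (fun z _ => ind _ (leqnn _) x z)) ind // pd eqxx andbT.
have [h3 _ hc] := md x y.
have [le|gt] := leqP (gdist x y) m.
  rewrite (eq_bigr (fun z => 1)); last first.
    move=> z /(gdist_adj Gconn Gbip x) h.
    by rewrite (_ : _ && _ = true) //; lia.
  by rewrite (sum_adj_const Greg) /=; ring.
(* The bound m + 3 and the parity leave only this distance. *)
have e : gdist x y = m.+2 by lia.
rewrite -(@sum_indicator m.+1 m.+1) //; last by left.
by rewrite hc //=; ring.
Qed.

Lemma pwalk_moore_distances :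
  (forall x y, side x (+) side y = odd m -> pwalk q c m x y = c) -> moore_distances.
Proof.
move=> hP.
have c0' := c0; have q1 := q_ge1.
have g0 j (x z : G) := gwalk_ge0 R Greg j x z.
(* P(A) >= c G_m(A) bounds the entries of G_m(A) by 1. *)
have gm (x y : G) : gwalk q m x y <= 1.
  have [ep|np] := eqVneq (side x (+) side y) (odd m); last first.
    by rewrite (gwalk_parity Gbip).
  have := hP x y ep; rewrite /pwalk; have := gwalk_leSS R Greg m x y.
  by have := g0 m x y; nra.
have Sm (x y : G) : side x (+) side y = odd m ->
    \sum_(z | adj y z) gwalk q m.+1 x z = c + (k%:R - c) * gwalk q m x y.
  by move=> /(hP x y); rewrite /pwalk gwalkSS; lra.
have k0 : (0 < k)%N by lia.
(* Let y be the last vertex before z on a walk of length m + 1. The k neighbours of y have entries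
   at least 1 with sum c + (k - c) = k, so all these entries are 1. *)
have gm1 (x z : G) : gwalk q m.+1 x z <= 1.
  have [w|] := boolP (walk m.+1 x z); last first.
    by rewrite walk_gwalk -leNgt => h; apply: le_trans h _.
  move: w; rewrite walkS => /existsP [y /andP [w yz]].
  have gy : gwalk q m x y = 1.
    apply/eqP; rewrite eq_le gm /=; move: w; rewrite walk_gwalk.
    by have [[|n] ->] := gwalk_natP R Greg m x y; rewrite ?ltxx // (ler_nat _ 1).
  have ge1 t : adj y t -> 0 <= gwalk q m.+1 x t - 1.
    move=> yt; have := walk_adj w yt; rewrite walk_gwalk.
    have [[|n] ->] := gwalk_natP R Greg m.+1 x t; rewrite ?ltxx //.
    by rewrite subr_ge0 (ler_nat _ 1).
  have : \sum_(t | adj y t) (gwalk q m.+1 x t - 1) == 0.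
    rewrite sumrB Sm ?(walk_parity Gbip w) // (sum_adj_const Greg) gy; apply/eqP; ring.
  rewrite psumr_eq0 // => /allP/(_ z (mem_index_enum _)); rewrite yz /= subr_eq0.
  by move=> /eqP ->.
have ind j (x y : G) : (j <= m.+1)%N ->
    gwalk q j x y = ((gdist x y <= j)%N && (odd (gdist x y) == odd j))%:R.
  move=> jm; apply: gwalk_indicator.
  have [ej|nj] := eqVneq (odd j) (odd m).
    by apply: le_trans (gm x y); apply: gwalk_le => //; lia.
  by apply: le_trans (gm1 x y); apply: gwalk_le => //=; lia.
(* Beyond distance m the sum in [Sm] equals c > 0, so some neighbour of y is reached by a walk of
   length m + 1. *)
have near (x y : G) : side x (+) side y = odd m -> (gdist x y <= m.+2)%N.
  move=> hxy; have [le|gt] := leqP (gdist x y) m; first by lia.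
  have : 0 < \sum_(z | adj y z) gwalk q m.+1 x z.
    by rewrite Sm // ind // leqNgt gt /= mulr0 addr0.
  have [/existsP [z /andP [yz w]] _|/existsPn nz] :=
      boolP [exists z, adj y z && walk m.+1 x z].
    apply: gdist_le => //; apply: walk_adj w _; by rewrite adj_sym.
  rewrite big1 ?ltxx // => z yz; have := nz z; rewrite yz walk_gwalk -leNgt => h.
  by apply/eqP; rewrite eq_le h g0.
move=> x y; split.
- have [/near|np] := eqVneq (side x (+) side y) (odd m); first by lia.
  (* In the other parity class any neighbour is within m + 2, which leaves m + 3 for y. *)
  have [z yz] := gdist_step Greg y k0.
  have : side x (+) side z = odd m.
    have := Gbip yz; move: np.
    by case: (side x); case: (side y); case: (side z); case: (odd m).
  move=> /near; have := gdist_adj Gconn Gbip x yz; lia.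
- case e : (gdist x y) => [|d] //= dm.
  apply/eqP; rewrite -(eqr_nat R); apply/eqP.
  rewrite (@sum_indicator d d) //; last by left.
  rewrite (eq_bigr (fun z => gwalk q d x z)); last by move=> z _; rewrite ind //; lia.
  case: d e dm => [|d] e dm.
    have xy : adj x y.
      have := gdist_walk Gconn x y; rewrite e walkS => /existsP [z].
      by rewrite walk0 => /andP [/eqP ->].
    rewrite (bigD1 x) 1?adj_sym //= gwalk0 eqxx big1 ?addr0 //.
    by move=> z /andP [_]; rewrite gwalk0 eq_sym => /negbTE ->.
  (* The recurrence read backwards: at distance d + 2 the sum is 1 + q * 0. *)
  have -> : \sum_(z | adj y z) gwalk q d.+1 x z = gwalk q d.+2 x y + q * gwalk q d x y.
    by rewrite gwalkSS; ring.
  rewrite !ind ?e ?leqnn ?eqxx //; last by lia.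
  by rewrite (_ : (d.+2 <= d)%N = false) ?mulr0 ?addr0 //; lia.
move=> e.
have hxy : side x (+) side y = odd m by rewrite -(gdist_parity Gconn Gbip) e /= negbK.
rewrite (@sum_indicator m.+1 m.+1) //; last by left.
rewrite -(eq_bigr _ (fun z _ => ind m.+1 x z (leqnn _))) Sm // ind // e.
by rewrite (_ : (m.+2 <= m)%N = false) ?mulr0 ?addr0 //; lia.
Qed.
End Moore.

(** * Distance-regularity from the local conditions *)

Section MooreDrg.
Variables (R : realType) (G : sgraph) (k m : nat) (c : R) (side : G -> bool).
Hypothesis Gconn : connected G.
Hypothesis Greg : regular k G.
Hypothesis Gbip : forall x y : G, adj x y -> side x != side y.
Hypothesis k2 : (2 <= k)%N.
Hypothesis c0 : 0 < c.
Hypothesis md : moore_distances G m c.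

(** The intersection number c_d. At m + 3 it is k, because no vertex is farther away. *)
Definition closer (d : nat) : R :=
  if d == 0%N then 0 else if (d <= m.+1)%N then 1 else if d == m.+2 then c else k%:R.

Lemma nbrs_at_closer (x y : G) (d : nat) : gdist x y = d.+1 ->
  (nbrs_at x y d)%:R = closer d.+1.
Proof.
move=> e; have [h1 h2 h3] := md x y; rewrite /closer /=.
have [dm|dm] := leqP d.+1 m.+1; first by have := h2; rewrite e dm => ->.
case: eqP => [e2|n2].
  by case: e2 e => ->; exact: h3.
rewrite -(nbrs_at_sum Gconn Gbip Greg e) (_ : nbrs_at x y d.+2 = 0%N) ?addn0 //.
apply: eq_card0 => z; rewrite inE; apply/negP => /andP [_ /eqP ez].
by have [h4 _ _] := md x z; lia.
Qed.

Lemma nbrs_at_value (x y : G) (j : nat) :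
  (nbrs_at x y j)%:R = if j.+1 == gdist x y then closer (gdist x y)
    else if j == (gdist x y).+1 then k%:R - closer (gdist x y) else 0.
Proof.
case: eqP => [e1|n1]; last case: eqP => [e2|n2]; last first.
- by rewrite (nbrs_at_far Gconn Gbip) //.
- case e : (gdist x y) => [|d].
    by rewrite e2 e -(gdist_eq0 Gconn e) (nbrs_at_root Gconn Gbip Greg) /closer subr0.
  rewrite -(nbrs_at_closer e) -(nbrs_at_sum Gconn Gbip Greg e) natrD e2 e; ring.
by rewrite -e1; apply: nbrs_at_closer.
Qed.

Lemma exists_next (x y : G) : closer (gdist x y) < k%:R ->
  exists z, gdist x z = (gdist x y).+1.
Proof.
move=> h; have : 0 < (nbrs_at x y (gdist x y).+1)%:R :> R.
  by rewrite nbrs_at_value eqxx (_ : _ == _ = false) ?subr_gt0 //; lia.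
by rewrite ltr0n => /card_gt0P [z]; rewrite inE => /andP [_ /eqP]; exists z.
Qed.

(** Up to m + 1 the number c_i is at most 1 < k, so some neighbour lies one step farther. *)
Lemma exists_at_dist (x : G) (i : nat) : (i <= m.+2)%N -> exists y, gdist x y = i.
Proof.
elim: i => [|i IHi] im; first by exists x; exact: gdistxx.
have [|y e] := IHi; first exact: ltnW.
rewrite -e; apply: exists_next; rewrite e /closer -ltnS im.
by case: eqP => _; rewrite ?ltr0n ?ltr1n; lia.
Qed.

(** A pair at distance m + 2 exists, so c counts neighbours there; this rules out non-integral c and
    c > k. *)
Lemma exists_natural_c : exists2 a : nat, c = a%:R & (0 < a <= k)%N.
Proof.
have /card_gt0P [x _] := Gconn.1.
have [y e] := exists_at_dist x (leqnn _).
have [_ _ /(_ e) ec] := md x y.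
exists (nbrs_at x y m.+1); first by [].
apply/andP; split; last by have := nbrs_at_sum Gconn Gbip Greg e; lia.
by have := c0; rewrite -ec ltr0n.
Qed.

Lemma moore_distance_regular : distance_regular G.
Proof.
split=> // x y x' y' e j; apply/eqP; rewrite -(eqr_nat R) !nbrs_at_value e.
exact: eqxx.
Qed.

Lemma diameterP (d : nat) (x y : G) : gdist x y = d ->
  (forall x y : G, (gdist x y <= d)%N) -> diameter G = d.
Proof.
move=> e le; apply/eqP; rewrite /diameter eqn_leq; apply/andP; split.
  by apply/bigmax_leqP => x' _; apply/bigmax_leqP => y' _.
rewrite -e; apply: leq_trans (leq_bigmax x); exact: leq_bigmax y.
Qed.

(** For c < k the number b_(m+2) = k - c is positive, so distance m + 3 occurs. *)
Lemma moore_quotient : c < k%:R -> bipartite_drg_with_quotient (Bmx k m.+4 c).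
Proof.
move=> ck; exists G; split; [by exists side | exact: moore_distance_regular |].
have /card_gt0P [x _] := Gconn.1.
exists x; split.
  have [y e] := exists_at_dist x (leqnn _).
  have [|z ez] := @exists_next x y.
    by rewrite e /closer /= ltnn eqxx.
  rewrite (@diameterP m.+3 x z) ?ez ?e // => x' y'.
  by have [] := md x' y'.
move=> i j y e; rewrite mxE nbrs_at_value e /closer /=.
have := ltn_ord i; have := ltn_ord j; move: (val i) (val j) => {e}i {}j hj hi.
repeat (case: eqP => ? || case: leqP => ?); first [by [] | exfalso; lia | ring].
Qed.

(** For c = k no vertex at distance m + 2 has a neighbour farther away, so the diameter is m + 2,
    and the last row of the smaller matrix records c_(m+2) = k. *)
Lemma moore_quotient_eq : c = k%:R ->
  bipartite_drg_with_quotient (Bmx k m.+3 (1 : R)).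
Proof.
move=> ck; exists G; split; [by exists side | exact: moore_distance_regular |].
have /card_gt0P [x _] := Gconn.1.
have le (x' y' : G) : (gdist x' y' <= m.+2)%N.
  have [h _ _] := md x' y'; rewrite leqNgt; apply/negP => gt.
  have e : gdist x' y' = m.+3 by lia.
  have [z yz ez] := gdist_pred Gconn e.
  have : 0 < (nbrs_at x' z m.+3)%:R :> R.
    rewrite ltr0n; apply/card_gt0P; exists y'; rewrite inE e eqxx andbT.
    by rewrite adj_sym.
  rewrite nbrs_at_value ez eqxx (_ : _ == _ = false); last by lia.
  by rewrite /closer /= ltnn eqxx ck subrr ltxx.
exists x; split.
  have [y e] := exists_at_dist x (leqnn _).
  by rewrite (@diameterP m.+2 x y).
move=> i j y e; rewrite mxE nbrs_at_value e /closer /= ck.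
have := ltn_ord i; have := ltn_ord j; move: (val i) (val j) => {e}i {}j hj hi.
repeat (case: eqP => ? || case: leqP => ?); first [by [] | exfalso; lia | ring].
Qed.
End MooreDrg.

(** * Local conditions from a quotient matrix *)

Section FromQuotient.
Variables (R : realType) (G : sgraph) (k m n : nat) (c : R) (side : G -> bool).
Variables (x0 : G) (Q : 'M[R]_n).
Hypothesis Gdrg : distance_regular G.
Hypothesis Gbip : forall x y : G, adj x y -> side x != side y.
Hypothesis Gquo : distance_quotient x0 Q.
Hypothesis n_lb : (m.+3 <= n)%N.
Hypothesis n_ub : (n <= m.+4)%N.
Hypothesis Q01 : forall i j : 'I_n, i = 0%N :> nat -> j = 1%N :> nat -> Q i j = k%:R.
Hypothesis Q1 : forall i j : 'I_n, i = j.+1 :> nat -> (i <= m.+1)%N -> Q i j = 1.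
Hypothesis Qc : forall i j : 'I_n, i = m.+2 :> nat -> j = m.+1 :> nat -> Q i j = c.

Lemma gdist_lt_quotient (x y : G) : (gdist x y < n)%N.
Proof.
rewrite Gquo.1 ltnS /diameter; apply: leq_trans (leq_bigmax x); exact: leq_bigmax y.
Qed.

(** The quotient describes distances from [x0] only. Distance-regularity transports the existence of
    a neighbour one step farther from any pair to a pair starting at [x0]. *)
Lemma quotient_dist_exists (x y : G) (i : nat) : (i <= gdist x y)%N ->
  exists y0, gdist x0 y0 = i.
Proof.
have Gconn := Gdrg.1.
elim: i x y => [|i IHi] x y le; first by exists x0; exact: gdistxx.
have [w' ew'] := gdist_descend Gconn le.
have [w wa ew] := gdist_pred Gconn ew'.
have [y0 e0] := IHi x y (ltnW le).
have e := Gdrg.2 _ _ _ _ (etrans e0 (esym ew)) i.+1.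
have : (0 < nbrs_at x w i.+1)%N.
  by apply/card_gt0P; exists w'; rewrite inE adj_sym wa ew' eqxx.
by rewrite -e => /card_gt0P [z]; rewrite inE => /andP [_ /eqP]; exists z.
Qed.

Lemma quotient_entry (x y : G) (i j : 'I_n) : gdist x y = i ->
  Q i j = (nbrs_at x y j)%:R.
Proof.
move=> e; have [y0 e0] : exists y0, gdist x0 y0 = i.
  by apply: (quotient_dist_exists (x := x) (y := y)); rewrite e.
by rewrite (Gquo.2 _ j _ e0) (Gdrg.2 _ _ x y) // e0.
Qed.

Lemma quotient_regular : regular k G.
Proof.
have Gconn := Gdrg.1.
have n1 : (1 < n)%N by lia.
move=> x; apply/eqP; rewrite -(eqr_nat R).
rewrite -(@Q01 (Ordinal (ltnW n1)) (Ordinal n1)) // (@quotient_entry x x) ?gdistxx //.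
rewrite eqr_nat; apply/eqP; apply: eq_card => z; rewrite !inE.
case: (boolP (adj x z)) => // xz; have := gdist_adj Gconn Gbip x xz.
by rewrite gdistxx //; case=> [->|].
Qed.

Lemma quotient_moore_distances : moore_distances G m c.
Proof.
have Gconn := Gdrg.1.
move=> x y; have lt := gdist_lt_quotient x y; split; first by lia.
- case e : (gdist x y) lt => [|d] //= lt dm.
  apply/eqP; rewrite -(eqr_nat R) -(@quotient_entry x y (Ordinal lt) (Ordinal (ltnW lt))) //.
  by rewrite Q1.
move=> e; rewrite e in lt.
by rewrite -(@quotient_entry x y (Ordinal lt) (Ordinal (ltnW lt))) // Qc.
Qed.
End FromQuotient.

(** * The complete bipartite graph as an admissible example *)

Section CompleteBipartite.
Variable k : nat.

Definition biclique_adj : rel (bool * 'I_k) := fun x y => x.1 != y.1.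

Lemma biclique_sym : symmetric biclique_adj.
Proof. by move=> x y; rewrite /biclique_adj eq_sym. Qed.

Lemma biclique_irr : irreflexive biclique_adj.
Proof. by move=> x; rewrite /biclique_adj eqxx. Qed.

Definition biclique : sgraph := SGraph biclique_sym biclique_irr.

Hypothesis k0 : (0 < k)%N.

Lemma biclique_connected : connected biclique.
Proof.
split; first by rewrite card_prod card_bool card_ord; lia.
move=> [a i] [b j].
have [e|ne] := eqVneq a b; last by apply: connect1; rewrite /= /biclique_adj.
apply: (@connect_trans _ _ ((~~ a, i) : biclique)).
  by apply: connect1; rewrite /= /biclique_adj /=; case: (a).
by apply: connect1; rewrite /= /biclique_adj /= e; case: (b).
Qed.

Lemma biclique_bip (x y : biclique) : adj x y -> x.1 != y.1.
Proof. by []. Qed.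

Lemma biclique_regular : regular k biclique.
Proof.
move=> [a i]; rewrite -[RHS]card_ord.
rewrite -(card_imset _ (f := fun j : 'I_k => (~~ a, j) : biclique)).
  apply: eq_card => -[b j]; rewrite !inE /= /biclique_adj /=.
  apply/idP/imsetP => [ab|[l _ [-> _]]]; last by case: (a).
  by exists j => //; congr (_, _); move: ab; case: (a); case: (b).
by move=> j l [].
Qed.

Lemma biclique_pwalk (R : realType) (x y : biclique) :
  x.1 (+) y.1 = odd 0 -> pwalk (k%:R - 1 : R) k%:R 0 x y = k%:R.
Proof.
move=> exy; rewrite /pwalk gwalkSS (eq_bigr (fun z => 1)).
  by rewrite (sum_adj_const biclique_regular); ring.
move=> z; rewrite gwalk1 /= /biclique_adj; move: exy.
by case: x.1; case: y.1; case: z.1.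
Qed.
End CompleteBipartite.

(** Makes the set of admissible graphs nonempty. With m = 0 and c = k, P is X^2, which has no
    positive root. *)
Lemma biclique_admissible (R : realType) (k : nat) (theta : R) :
  (2 <= k)%N -> 0 <= theta -> admissible k theta (biclique k).
Proof.
move=> k2 t0; have k0 : (0 < k)%N by exact: ltnW.
have kR : 0 < k%:R :> R by rewrite ltr0n.
split; [exact: biclique_connected | by exists (fun x => x.1) | exact: biclique_regular |].
have nr x : theta < x -> ~~ root (ppoly (k%:R - 1 : R) k%:R 0) x.
  move=> tx; rewrite /root horner_ppoly horner_gpolySS horner_gpoly1 horner_gpoly0.
  rewrite (_ : _ + _ = x * x); last by ring.
  have x0 : x != 0 by apply/eqP; lra.
  by rewrite mulf_eq0 negb_or x0.
by have [] := pwalk_const_spectrum (@biclique_regular k) (@biclique_bip k)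
  (biclique_connected k0).1 k2 t0 nr (@biclique_pwalk k R).
Qed.

(** * The value of the bound and the existence of the maximum *)

(** At k, G_(m+2) exceeds G_m by (k - 1)^(m+1) + (k - 1)^(m+2); the factor c clears the denominators
    of [Mbound]. *)
Lemma Mbound_ppoly (R : realType) (k m : nat) (c : R) : 0 < c ->
  c * Mbound k m.+4 c = 2 * (ppoly (k%:R - 1) c m).[k%:R].
Proof.
move=> c0; have cn : c != 0 by apply: lt0r_neq0.
have e j : (gpoly (k%:R - 1) j).[k%:R] = \sum_(0 <= i < j.+1) (k%:R - 1) ^+ i :> R.
  by rewrite -gpoly_degree_value subrK.
rewrite horner_ppoly !e /Mbound.
rewrite (_ : (m.+4 - 4 = m)%N); last by lia.
rewrite (_ : (m.+4 - 3 = m.+1)%N); last by lia.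
rewrite (_ : (m.+4 - 2 = m.+2)%N); last by lia.
rewrite [in RHS]big_nat_recr //= [in RHS]big_nat_recr //=.
by field.
Qed.

Lemma is_b_exists (R : realType) (k : nat) (theta B : R) :
  (exists G, admissible k theta G) ->
  (forall G, admissible k theta G -> #|G|%:R <= B) ->
  exists2 b : nat, is_b k theta b & b%:R <= B.
Proof.
move=> [G0 aG0] hB.
(* Excluded middle makes the attained orders a boolean predicate, as [ex_maxnP] requires. *)
pose P n := `[< exists G, admissible k theta G /\ #|G| = n >].
have exP : exists n, P n by exists #|G0|; apply/asboolP; exists G0.
have hn n : P n -> n%:R <= B by move=> /asboolP [G [aG <-]]; exact: hB.
have bd n : P n -> (n <= Num.bound B)%N.
  move=> /hn h; rewrite -(ler_nat R); apply: le_trans h _.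
  by apply/ltW/archi_boundP/(le_trans _ (hB _ aG0)); rewrite ler0n.
case: (ex_maxnP exP bd) => b Pb bmax.
exists b; last exact: hn.
move: (Pb) => /asboolP [G [aG eG]]; split; first by exists G.
by move=> H aH; apply: bmax; apply/asboolP; exists H.
Qed.


(** Both quotient matrices give the same local conditions: in the smaller one the last row supplies
    c_(m+2) = k = c. *)
Lemma drg_regular_moore (R : realType) (k m : nat) (c : R) :
  (bipartite_drg_with_quotient (Bmx k m.+4 c) \/
   (c = k%:R /\ bipartite_drg_with_quotient (Bmx k m.+3 (1 : R)))) ->
  exists G : sgraph, [/\ connected G, bipartite G, regular k G & moore_distances G m c].
Proof.
case=> [[H [[side hb] hd [x0 hq]]]|[ck [H [[side hb] hd [x0 hq]]]]].
  exists H; split; [exact: hd.1 | by exists side | |].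
    apply: (quotient_regular (m := m) hd hb hq) => //.
    by move=> i j ei ej; rewrite mxE ei ej.
  apply: (quotient_moore_distances (m := m) hd hq) => //.
    move=> i j e im; rewrite mxE e eqxx.
    have -> : (j.+1 == m.+3) = false by lia.
    by have -> : (j.+1 == m.+2) = false by lia.
  by move=> i j ei ej; rewrite mxE ei ej /= eqxx; have -> : (m.+2 == m.+3) = false by lia.
exists H; split; [exact: hd.1 | by exists side | |].
  apply: (quotient_regular (m := m) hd hb hq) => //.
  by move=> i j ei ej; rewrite mxE ei ej.
apply: (quotient_moore_distances (m := m) hd hq) => //.
  move=> i j e im; rewrite mxE e eqxx.
  have -> : (j.+1 == m.+2) = false by lia.
  by case: ifP.
by move=> i j ei ej; rewrite mxE ei ej /= eqxx ck.
Qed.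

Theorem theorem4p1 (R : realType) (k t : nat) (c theta : R)
    (hk : (2 <= k)%N) (ht : (4 <= t)%N) (hc : 0 < c)
    (htheta : theta = lambda2 (Bmx k t c)) (htheta0 : 0 <= theta) :
  exists b : nat,
    [/\ is_b k theta b,
        b%:R <= Mbound k t c
      & b%:R = Mbound k t c <->
          (1 <= c < k%:R /\ bipartite_drg_with_quotient (Bmx k t c)) \/
          (c = k%:R /\ bipartite_drg_with_quotient (Bmx k t.-1 (1 : R)))].
Proof.
case: t ht htheta => [|[|[|[|m]]]] // _ htheta.
have [rt nr tk] := lambda2_Bmx hk hc htheta htheta0.
have ME := Mbound_ppoly k m hc.
have bound (G : sgraph) : admissible k theta G -> #|G|%:R <= Mbound k m.+4 c.
  move=> [hcon [side hb] hr l2].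
  have [h _] := moore_bound hr hb hcon.1 hk hc htheta0 tk rt nr l2.
  by rewrite -(ler_pM2l hc) ME.
have [|b hb hbM] := @is_b_exists R k theta (Mbound k m.+4 c) _ bound.
  by exists (biclique k); exact: biclique_admissible.
exists b; split=> //; split.
  move=> eb; have [[G [[hcon [side hbip] hr l2] eG]] _] := hb.
  have [_ h] := moore_bound hr hbip hcon.1 hk hc htheta0 tk rt nr l2.
  have hp : forall x y, side x (+) side y = odd m -> pwalk (k%:R - 1) c m x y = c.
    by apply: h; rewrite eG eb.
  have md := pwalk_moore_distances hcon hr hbip hk hc hp.
  (* Integrality turns c > 0 into 1 <= c, and also gives c <= k. *)
  have [a ea /andP [a1 ak]] := exists_natural_c hcon hr hbip hk hc md.
  have [ck|ck] := eqVneq c k%:R.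
    by right; split=> //; apply: (moore_quotient_eq hcon hr hbip hk hc md).
  have clt : c < k%:R by rewrite lt_neqAle ck ea ler_nat.
  left; split; first by rewrite clt andbT ea (ler_nat _ 1).
  exact: (moore_quotient hcon hr hbip hk hc md).
move=> h.
have [|G [hcon [side hbip] hr md]] := @drg_regular_moore R k m c.
  by case: h => [[_ h]|h]; [left | right].
have hp := moore_distances_pwalk hcon hr hbip hk hc md.
have [e l2] := pwalk_const_spectrum hr hbip hcon.1 hk htheta0 nr hp.
(* The graph [G] is admissible and has exactly M(k,t,c) vertices, so the maximum [b] is at least
   that. *)
apply/eqP; rewrite eq_le hbM /=.
have -> : Mbound k m.+4 c = #|G|%:R by apply: (mulfI (lt0r_neq0 hc)); rewrite ME.
by rewrite ler_nat; apply: hb.2; split=> //; exists side.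
Qed.
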